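(* Let $n\ge d\ge 3$ and let $Q$ be a $d$-braxtope with vertex array $x_0<x_1<\cdots<x_n$. 1. For $1\le i\le n-d+1$, let $J_i=[x_0,x_i,x_{i+1},\ldots,x_{i+d-1}]$. Then $\{J_1,J_2,\ldots,J_{n-d+1}\}$ are the facets (maximal simplices) of a triangulation $\Delta$ of $Q$. 2. $\Delta$ is a shallow triangulation of $Q$. 3. The $h$-vector of $Q$ is $h(Q)=(h_0,h_1,\ldots,h_d)=(1,n-d+1,n-d+1,\ldots,n-d+1,1)$, i.e. $h_0=h_d=1$ and $h_i=n-d+1$ for $1\le i\le d-1$.
   Context: $[y_1,\ldots,y_s]$ denotes the convex hull of the points $y_1,\dots,y_s$. A vertex array of a polytope $P$ with (distinct) vertices $x_0,\ldots,x_n$ is a total ordering $x_0<x_1<\cdots<x_n$ of its vertex set. Definition. For $n\ge d\ge 3$, a $d$-polytope $P$ with $n+1$ vertices is a $d$-braxtope with vertex array $x_0<x_1<\cdots<x_n$ if the facets of $P$ are exactly $$T_i=[x_i,x_{i+1},\ldots,x_{i+d-1}]\quad\text{for } 0\le i\le n-d+1$$ and $$E_j=[x_0,x_{j-(d-2)},\ldots,x_{j-1},x_{j+1},\ldots,x_{j+(d-2)}]\quad\text{for } 2\le j\le n,$$ under the convention $x_t=x_0$ for $t\le 0$ and $x_t=x_n$ for $t\ge n$ (so $E_n=[x_0,x_{n-(d-2)},\ldots,x_{n-1},x_n]$). A triangulation of a polytope $P$ is a geometric simplicial complex whose vertices are vertices of $P$ and whose underlying space is $P$. A triangulation $\Delta$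 of $P$ is shallow if every $k$-face (that is, $k$-dimensional simplex) of $\Delta$ is contained in a face of $P$ of dimension at most $2k$ ($P$ itself counts as a face of $P$). The $h$-vector of a (not necessarily simplicial) polytope is the toric $h$-vector (for rational polytopes, the middle perversity Betti numbers of the associated toric variety), defined combinatorially by recursion: $g(\emptyset,x)=1$, and for a polytope $P$ of dimension $d\ge 0$, $$h(P,x)=\sum_{F} g(F,x)\,(x-1)^{d-1-\dim F},$$ where $F$ runs over all faces of $P$ with $F\ne P$, including $F=\emptyset$ (with $\dim\emptyset=-1$). Writing $h(P,x)=\sum_{i=0}^d h_i x^{d-i}$ (a palindromic polynomial, $h_i=h_{d-i}$), one sets $g(P,x)=h_0+\sum_{i=1}^{\lfloor d/2\rfloor}(h_i-h_{i-1})x^i$, and $h(P)=(h_0,h_1,\ldots,h_d)$. For simplicial $P$ this agrees with $h_i(P)=\sum_{j=0}^i(-1)^{i-j}\binom{d-j}{d-i}f_{j-1}(P)$, where $f_j(P)$ is the number of $j$-faces of $P$. *)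

(* Defs.v *)
From HB Require Import structures.
From mathcomp Require Import all_boot all_order all_algebra.
From mathcomp Require Import boolp classical_sets functions cardinality fsbigop.
From mathcomp Require Import reals.

Set Implicit Arguments.
Unset Strict Implicit.
Unset Printing Implicit Defensive.

Import Order.TTheory GRing.Theory Num.Theory.

Local Open Scope classical_set_scope.
Local Open Scope ring_scope.

Definition conv (R : realType) (m : nat) (A : set 'rV[R]_m) : set 'rV[R]_m :=
  [set y | exists k : nat, exists p : 'I_k -> 'rV[R]_m, exists c : 'I_k -> R,
    [/\ forall i, A (p i), forall i, 0 <= c i, \sum_i c i = 1
      & y = \sum_i c i *: p i]].

Definition aff_indep (R : realType) (m k : nat) (p : 'I_k -> 'rV[R]_m) : Prop :=
  forall c : 'I_k -> R,
    \sum_i c i = 0 -> \sum_i c i *: p i = 0 -> forall i, c i = 0.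

(* The largest size of an affinely independent family in A. The bound on k is
   harmless: such a family in R^m has at most m + 1 members. *)
Definition affrank (R : realType) (m : nat) (A : set 'rV[R]_m) : nat :=
  (\max_(k < m.+2 | `[< exists2 p : 'I_k -> 'rV[R]_m,
                          aff_indep p & forall i, A (p i) >]) k)%N.

(* dim set0 = -1 *)
Definition dim (R : realType) (m : nat) (A : set 'rV[R]_m) : int :=
  (affrank A)%:Z - 1.

Definition polytope (R : realType) (m : nat) (P : set 'rV[R]_m) : Prop :=
  exists2 V : set 'rV[R]_m, finite_set V & P = conv V.

(* F is cut out of P by a valid linear inequality z *m a <= b; taking a = 0
   shows that set0 and P itself are faces. *)
Definition face (R : realType) (m : nat) (P F : set 'rV[R]_m) : Prop :=
  exists (a : 'cV[R]_m) (b : R),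
    (forall z, P z -> (z *m a) 0 0 <= b) /\
    F = P `&` [set z | (z *m a) 0 0 = b].

Definition facets (R : realType) (m : nat) (P : set 'rV[R]_m) :
    set (set 'rV[R]_m) :=
  [set F | face P F /\ dim F = dim P - 1].

Definition vertices (R : realType) (m : nat) (P : set 'rV[R]_m) :
    set 'rV[R]_m :=
  [set v | face P [set v]].

Definition vertex_array (R : realType) (m n : nat) (P : set 'rV[R]_m)
    (x : 'I_n.+1 -> 'rV[R]_m) : Prop :=
  injective x /\ vertices P = range x.

(* x_t for t >= 0, with x_t = x_n for t >= n. The convention x_t = x_0 for
   t <= 0 is obtained below by writing indices with the truncated subtraction
   of nat. *)
Definition xat (R : realType) (m n : nat) (x : 'I_n.+1 -> 'rV[R]_m) (t : nat) :
    'rV[R]_m :=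
  x (inord (minn t n)).

Definition braxT (R : realType) (m n : nat) (d : nat)
    (x : 'I_n.+1 -> 'rV[R]_m) (i : nat) : set 'rV[R]_m :=
  conv [set xat x t | t in [set t | i <= t <= i + d - 1]%N].

Definition braxE (R : realType) (m n : nat) (d : nat)
    (x : 'I_n.+1 -> 'rV[R]_m) (j : nat) : set 'rV[R]_m :=
  conv ([set xat x 0]
        `|` [set xat x (j - k) | k in [set k | 1 <= k <= d - 2]%N]
        `|` [set xat x (j + k) | k in [set k | 1 <= k <= d - 2]%N]).

Definition braxtope (R : realType) (m n : nat) (d : nat)
    (x : 'I_n.+1 -> 'rV[R]_m) (P : set 'rV[R]_m) : Prop :=
  [/\ polytope P, dim P = d%:Z, vertex_array P x
    & facets P = [set braxT d x i | i in [set i | i <= n - d + 1]%N]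
                 `|` [set braxE d x j | j in [set j | 2 <= j <= n]%N]].

Definition braxJ (R : realType) (m n : nat) (d : nat)
    (x : 'I_n.+1 -> 'rV[R]_m) (i : nat) : set 'rV[R]_m :=
  conv ([set xat x 0] `|` [set xat x t | t in [set t | i <= t <= i + d - 1]%N]).

(* k = 0 gives the empty simplex, a member of every nonempty complex. *)
Definition simplex (R : realType) (m : nat) (S : set 'rV[R]_m) : Prop :=
  exists k : nat, exists2 p : 'I_k -> 'rV[R]_m, aff_indep p & S = conv (range p).

Definition simplicial_complex (R : realType) (m : nat)
    (K : set (set 'rV[R]_m)) : Prop :=
  [/\ finite_set K,
      forall S, K S -> simplex S,
      forall S F, K S -> face S F -> K F
    & forall S T, K S -> K T -> face S (S `&` T) /\ face T (S `&` T)].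

Definition triangulation (R : realType) (m : nat) (P : set 'rV[R]_m)
    (K : set (set 'rV[R]_m)) : Prop :=
  [/\ simplicial_complex K,
      forall v, K [set v] -> vertices P v
    & \bigcup_(S in K) S = P].

Definition maximal_simplices (R : realType) (m : nat)
    (K : set (set 'rV[R]_m)) : set (set 'rV[R]_m) :=
  [set S | K S /\ forall T, K T -> S `<=` T -> T = S].

Definition shallow (R : realType) (m : nat) (P : set 'rV[R]_m)
    (K : set (set 'rV[R]_m)) : Prop :=
  forall (k : nat) (S : set 'rV[R]_m), K S -> dim S = k%:Z ->
    exists F, [/\ face P F, dim F <= (2 * k)%:Z & S `<=` F].

(* h(P,x) in terms of a given g. A polytope has finitely many faces, so the
   finitely supported sum is the genuine one, and the exponent
   dim P - 1 - dim F is nonnegative for F a proper face. *)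
Definition h_from_g (R : realType) (m : nat) (g : set 'rV[R]_m -> {poly int})
    (P : set 'rV[R]_m) : {poly int} :=
  \sum_(F \in [set F | face P F /\ F <> P])
     (g F * ('X - 1) ^+ `|(dim P - 1 - dim F)%R|%N).

(* In h = \sum_i h_i x^(d-i) the entry h_i is the coefficient of x^(d-i). *)
Definition h_entry (d : nat) (h : {poly int}) (i : nat) : int := h`_(d - i).

Definition g_from_h (d : nat) (h : {poly int}) : {poly int} :=
  (h_entry d h 0)%:P
  + \sum_(1 <= i < (d./2).+1) (h_entry d h i - h_entry d h i.-1)%:P * 'X^i.

(* The recursion on dimension, with fuel k; see toric_gE. *)
Fixpoint toric_g_rec (R : realType) (m : nat) (k : nat) (P : set 'rV[R]_m) :
    {poly int} :=
  if k is k'.+1 then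
    if `[< P = set0 >] then 1
    else g_from_h (affrank P).-1 (h_from_g (toric_g_rec k') P)
  else 1.

Definition toric_g (R : realType) (m : nat) (P : set 'rV[R]_m) : {poly int} :=
  toric_g_rec (affrank P) P.

Definition toric_h (R : realType) (m : nat) (P : set 'rV[R]_m) : {poly int} :=
  h_from_g (@toric_g R m) P.

Definition h_vector (R : realType) (m : nat) (P : set 'rV[R]_m) : seq int :=
  let d := (affrank P).-1 in [seq h_entry d (toric_h P) i | i <- iota 0 d.+1].

Lemma aff_dep (K : fieldType) (m k : nat) (p : 'I_k -> 'rV[K]_m) :
  (m.+1 < k)%N ->
  exists c : 'I_k -> K,
    [/\ \sum_i c i = 0, \sum_i c i *: p i = 0 & exists i, c i != 0].
Proof.
move=> mk; pose M : 'M[K]_(k, 1 + m) := \matrix_i row_mx 1%:M (p i).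
have : kermx M != 0.
  by rewrite kermx_eq0 /row_free neq_ltn (leq_ltn_trans (rank_leq_col M)).
case/rowV0Pn => v /sub_kermxP vM /rV0Pn[i vi].
have vE : \sum_i v 0 i *: row_mx 1%:M (p i) = 0 :> 'rV[K]_(1 + m).
  rewrite -[RHS]vM mulmx_sum_row; apply: eq_bigr => j _.
  by rewrite rowK.
exists (v 0); split; last by exists i.
  have /(congr1 lsubmx)/matrixP/(_ 0 0) := vE.
  rewrite raddf_sum summxE linear0 [RHS]mxE => v0; rewrite -[RHS]v0.
  by apply: eq_bigr => j _ /=; rewrite linearZ /= row_mxKl !mxE eqxx mulr1.
have /(congr1 rsubmx) := vE.
rewrite raddf_sum linear0 => v0; rewrite -[RHS]v0.
by apply: eq_bigr => j _ /=; rewrite linearZ /= row_mxKr.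
Qed.

Lemma aff_indep_bound (R : realType) (m k : nat) (p : 'I_k -> 'rV[R]_m) :
  aff_indep p -> (k < m.+2)%N.
Proof.
move=> ip; rewrite ltnS leqNgt; apply/negP => /(aff_dep p)[c [c0 cp [i]]].
by rewrite (ip c) ?eqxx.
Qed.

Lemma affrank_ge (R : realType) (m k : nat) (A : set 'rV[R]_m)
    (p : 'I_k -> 'rV[R]_m) :
  aff_indep p -> (forall i, A (p i)) -> (k <= affrank A)%N.
Proof.
move=> ip Ap; have km := aff_indep_bound ip.
by apply: (leq_bigmax_cond (Ordinal km)); apply/asboolP; exists p.
Qed.

Lemma affrank_witness (R : realType) (m : nat) (A : set 'rV[R]_m) :
  exists2 p : 'I_(affrank A) -> 'rV[R]_m, aff_indep p & forall i, A (p i).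
Proof.
pose B := [pred k : 'I_m.+2 | `[< exists2 p : 'I_k -> 'rV[R]_m,
                                    aff_indep p & forall i, A (p i) >]].
have [|k /asboolP kP kE] := @eq_bigmax_cond _ B (@nat_of_ord _).
  apply/card_gt0P; exists ord0; apply/asboolP.
  by exists (fun=> 0) => [c _ _|] [].
suff -> : affrank A = k by [].
by rewrite -kE; apply: eq_bigl.
Qed.

Lemma affrank_face (R : realType) (m : nat) (P F : set 'rV[R]_m) :
  face P F -> F <> P -> (affrank F < affrank P)%N.
Proof.
case=> a [b [Pab FE]] FP.
have [v Pv vb] : exists2 v, P v & (v *m a) 0 0 <> b.
  apply: contrapT => nv; apply: FP; rewrite FE; apply/seteqP; split.
    by move=> z [].
  move=> z Pz; split=> //=; apply: contrapT => zb; apply: nv; by exists z.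
have [p ip Fp] := affrank_witness F.
have {Fp} [Pp pb] : (forall i, P (p i)) /\ (forall i, (p i *m a) 0 0 = b).
  have FPb z : F z -> P z /\ (z *m a) 0 0 = b by rewrite FE.
  by split=> i; case: (FPb _ (Fp i)).
pose q (i : 'I_(affrank F).+1) := if unlift ord0 i is Some j then p j else v.
have q0 : q ord0 = v by rewrite /q unlift_none.
have qS j : q (lift ord0 j) = p j by rewrite /q liftK.
apply: (@affrank_ge _ _ _ _ q) => [c|i]; last first.
  by rewrite /q; case: unliftP.
rewrite !big_ord_recl q0 => c0 cq.
have {}cq : c ord0 *: v + \sum_i c (lift ord0 i) *: p i = 0.
  by rewrite -[RHS]cq; congr (_ + _); apply: eq_bigr => i _; rewrite qS.
have c00 : c ord0 = 0.
  have := congr1 (fun z => (z *m a) 0 0) cq.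
  rewrite mulmxDl mul0mx -scalemxAl mulmx_suml mxE [in LHS]mxE summxE [RHS]mxE.
  rewrite (eq_bigr (fun i => c (lift ord0 i) * b)) => [|i _]; last first.
    by rewrite -scalemxAl mxE pb.
  have -> : \sum_(i < affrank F) c (lift ord0 i) * b = - c ord0 * b.
    by rewrite -mulr_suml; congr (_ * b); apply/eqP; rewrite -addr_eq0 addrC c0.
  rewrite mulNr -mulrBr => /eqP; rewrite mulf_eq0 subr_eq0 => /orP[/eqP//|].
  by move/eqP.
move=> i; case: (unliftP ord0 i) => [j|] -> //.
apply: (ip (fun j => c (lift ord0 j))).
  by move: c0; rewrite c00 add0r.
by move: cq; rewrite c00 scale0r add0r.
Qed.

Lemma toric_g_recE (R : realType) (m k : nat) (P : set 'rV[R]_m) :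
  (affrank P <= k)%N -> toric_g_rec k P = toric_g P.
Proof.
rewrite /toric_g; move: {2}(affrank P) (leqnn (affrank P)) => e.
elim: e k P => [|e IH] [|k] P.
- by rewrite !leqn0 => /eqP -> .
- rewrite leqn0 => /eqP P0 _; rewrite P0 /=; case: asboolP => // /eqP/set0P[v Pv].
  suff : (1 <= affrank P)%N by rewrite P0.
  apply: (@affrank_ge _ _ _ _ (fun=> v)) => // c.
  by rewrite big_ord1 => c0 _ i; rewrite ord1.
- by rewrite leqn0 => _ /eqP ->.
move=> Pe Pk; case P0 : (affrank P) => [|r] /=.
  case: asboolP => // /eqP/set0P[v Pv].
  suff : (1 <= affrank P)%N by rewrite P0.
  apply: (@affrank_ge _ _ _ _ (fun=> v)) => // c.
  by rewrite big_ord1 => c0 _ i; rewrite ord1.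
case: asboolP => // _; congr g_from_h; rewrite /h_from_g.
apply: eq_fsbigr => F; rewrite inE => -[FP nFP].
have := affrank_face FP nFP; rewrite P0 ltnS => Fr.
have Fe : (affrank F <= e)%N by rewrite (leq_trans Fr)// -ltnS -P0.
rewrite (IH k) ?(IH r)//.
by rewrite -ltnS (leq_trans _ Pk)// P0 ltnS.
Qed.

Lemma toric_g0 (R : realType) (m : nat) : toric_g (set0 : set 'rV[R]_m) = 1.
Proof. by rewrite /toric_g; case: affrank => //= k; case: asboolP. Qed.

Lemma toric_gE (R : realType) (m : nat) (P : set 'rV[R]_m) :
  P <> set0 -> toric_g P = g_from_h (affrank P).-1 (toric_h P).
Proof.
move=> P0; rewrite -(@toric_g_recE _ _ (affrank P).+1)//=.
case: asboolP => // _; congr g_from_h; apply: eq_fsbigr => F.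
by rewrite inE => -[FP nFP]; rewrite toric_g_recE// ltnW// affrank_face.
Qed.

(* Main.v *)
Require Import Defs.
From mathcomp Require Import all_boot all_order all_algebra.
From mathcomp Require Import boolp classical_sets functions cardinality fsbigop.
From mathcomp Require Import reals.
From mathcomp Require Import zify ring lra.

(** Three facts are to be proved about the simplices J_i, which are the cones with
    apex x_0 over the T_i with i >= 1.

    The triangulation. The facets that miss x_0 are exactly the T_i with i >= 1,
    and they are simplices, so the J_i form the pulling triangulation at x_0.
    A point z other than x_0 lies in the cone over the facet through which the
    ray from x_0 to z leaves the polytope ([pull_cover]). Two cones meet in the cone
    over the intersection of their bases: let u and v be the affine functions
    that vanish on the bases and equal 1 at x_0; then u <= v on the first
    cone and v <= u on the second ([pull_inter]). Everything about faces comes from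
    [farkas] and from [extremal_functional], which turns a valid inequality into one
    that defines a facet.

    Shallowness. A simplex with x_0 and k more vertices in a window of d positions
    lies in E_h for each position h in the interior of the window that it does not
    use. There are at least d - 2 - k such h, and intersecting the facets E_h one
    by one lowers the dimension each time, since x_h is lost. The resulting face
    has dimension at most k + 2, which settles k >= 2; small k are treated by hand
    ([holes_rank], [shallow_carrier]).

    The toric h-vector. Call carrier of a simplex the smallest face containing it,
    and suppose that for every proper face F the polynomial g(F) is the sum of
    (x - 1)^(dim F - dim s) over the simplices s carried by F. Grouping simplices
    by carrier, h(Q) is then the sum of (x - 1)^(d - 1 - dim s) over the simplices
    in the boundary ([carrier_sum]). So (x - 1) h(Q) is a sum over all simplices minus
    a sum over the interior ones. The first is x^(d+1) + (n - d) x^d, because each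
    J_(i+1) adds to its predecessors just its subsets that contain the last vertex
    ([Delta_sum]). The second is 1 + (n - d) x, because the interior simplices are the
    n - d + 1 simplices J_i and the n - d intersections of consecutive ones
    ([ba_interior_sum]). This determines h(Q), and g(Q) turns out to be 1 + (n - d) x,
    so the hypothesis on g passes on to Q ([stacked_step]). The induction runs over
    the dimension: a facet is a simplex or some E_j with 2 <= j < n, and E_j is
    a braxtope of dimension d - 1 on its own vertices, triangulated by the
    restriction of the same simplices ([ba_facet], [Delta_skip]). *)

Set Implicit Arguments.
Unset Strict Implicit.
Unset Printing Implicit Defensive.

Import Order.TTheory GRing.Theory Num.Theory.

Local Open Scope ring_scope.

(** * Linear inequalities *)

Section Farkas.
Variables (R : realFieldType) (r : nat).
Implicit Types (u : 'cV[R]_r) (b : 'rV[R]_r).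

Definition dot b u : R := (b *m u) 0 0.

Lemma dotDl b1 b2 u : dot (b1 + b2) u = dot b1 u + dot b2 u.
Proof. by rewrite /dot mulmxDl mxE. Qed.
Lemma dotZl a b u : dot (a *: b) u = a * dot b u.
Proof. by rewrite /dot -scalemxAl mxE. Qed.
Lemma dotNl b u : dot (- b) u = - dot b u.
Proof. by rewrite -scaleN1r dotZl mulN1r. Qed.
Lemma dotDr b u v : dot b (u + v) = dot b u + dot b v.
Proof. by rewrite /dot mulmxDr mxE. Qed.
Lemma dotZr a b u : dot b (a *: u) = a * dot b u.
Proof. by rewrite /dot -scalemxAr mxE. Qed.
Lemma dotNr b u : dot b (- u) = - dot b u.
Proof. by rewrite -scaleN1r dotZr mulN1r. Qed.
Lemma dot0l u : dot 0 u = 0.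
Proof. by rewrite /dot mul0mx mxE. Qed.
Lemma dot_suml (I : Type) (s : seq I) (F : I -> 'rV[R]_r) u :
  dot (\sum_(i <- s) F i) u = \sum_(i <- s) dot (F i) u.
Proof. by rewrite /dot mulmx_suml summxE. Qed.
Lemma dot_row (N : nat) (W : 'M[R]_(N, r)) i u : dot (row i W) u = (W *m u) i 0.
Proof. by rewrite /dot -row_mul mxE. Qed.

Lemma dot_trmx b : b != 0 -> 0 < dot b b^T.
Proof.
move=> b0; rewrite /dot mxE.
have /rV0Pn[i bi] := b0.
rewrite (bigD1 i)//= mxE ltr_wpDr// ?sumr_ge0// => [j _|].
  by rewrite mxE -expr2 sqr_ge0.
by rewrite -expr2 exprn_even_gt0.
Qed.

(** Induction on the number of generators. If dropping the first generator [l]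
    breaks the hypothesis, a functional [u0] witnesses it and is negative on
    [l]; projecting along [l] onto the kernel of [u0] then reduces the claim to
    the remaining generators. *)
Lemma farkas (N : nat) (w : 'I_N -> 'rV[R]_r) b :
  (forall u, (forall i, 0 <= dot (w i) u) -> 0 <= dot b u) ->
  exists2 c : 'I_N -> R, forall i, 0 <= c i & b = \sum_i c i *: w i.
Proof.
elim: N w b => [|N IH] w b wb.
  exists (fun=> 0) => //; rewrite big_ord0; apply/eqP; apply: contraT => b0.
  have : 0 <= dot b (- b^T) by apply: wb => -[].
  by rewrite dotNr oppr_ge0 leNgt dot_trmx.
pose a i := w (lift ord0 i); set l := w ord0.
have [/IH[c c0 bE]|] :=
    pselect (forall u, (forall i, 0 <= dot (a i) u) -> 0 <= dot b u).
  exists (fun i => if unlift ord0 i is Some j then c j else 0) => [i|].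
    by case: unlift.
  rewrite big_ord_recl unlift_none scale0r add0r bE.
  by apply: eq_bigr => i _; rewrite liftK.
move=> /existsNP[u0 /not_implyP[au0 /negP]]; rewrite -ltNge => bu0.
have lu0 : dot l u0 < 0.
  rewrite ltNge; apply/negP => l0; move: bu0; rewrite ltNge wb// => i.
  case: (unliftP ord0 i) => [j|] -> //; exact: au0.
pose pr (z : 'rV[R]_r) := z - (dot z u0 / dot l u0) *: l.
have [|c c0 bE] := IH (fun i => pr (a i)) (pr b).
  move=> u au; pose u1 := u - (dot l u / dot l u0) *: u0.
  (* [u1] is [u] corrected to vanish on [l]: the projection [pr] is its adjoint. *)
  have prE z : dot (pr z) u = dot z u1.
    rewrite /pr /u1 dotDl dotNl dotZl dotDr dotNr dotZr.
    by congr (_ - _); ring.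
  rewrite prE; apply: wb => i; case: (unliftP ord0 i) => [j|] ->.
    rewrite -prE; exact: au.
  by rewrite -/l /u1 dotDr dotNr dotZr divfK ?subrr// lt_eqF.
(* The coefficient of [l] that undoes the projections of [b] and of the [a i]. *)
pose c0' := (dot b u0 - \sum_i c i * dot (a i) u0) / dot l u0.
exists (fun i => if unlift ord0 i is Some j then c j else c0') => [i|].
  case: unlift => //=; rewrite /c0' mulr_le0// ?invr_le0 ?(ltW lu0)//.
  by rewrite subr_le0 (le_trans (ltW bu0))// sumr_ge0// => j _; rewrite mulr_ge0.
rewrite big_ord_recl unlift_none -/l.
under eq_bigr do rewrite liftK.
transitivity (pr b + (dot b u0 / dot l u0) *: l); first by rewrite /pr subrK.
rewrite bE /c0' mulrBl scalerBl.
rewrite (eq_bigr (fun i => c i *: a i - (c i * dot (a i) u0 / dot l u0) *: l)).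
  by rewrite sumrB -scaler_suml mulr_suml addrC addrA addrAC.
by move=> i _; rewrite /pr scalerBr scalerA mulrA.
Qed.

(** Rows off the kernel are replaced by [0] rather than deleted, which keeps the
    indexing of [W]; the rank is that of the face exposed by [u]. *)
Definition zrows (N : nat) (W : 'M[R]_(N, r)) u : 'M[R]_(N, r) :=
  \matrix_i if dot (row i W) u == 0 then row i W else 0.

Lemma zrows_mul N (W : 'M[R]_(N, r)) u : zrows W u *m u = 0.
Proof.
apply/matrixP => i j; rewrite ord1 -dot_row rowK [RHS]mxE.
by case: eqP => [//|_]; rewrite dot0l.
Qed.

Lemma zrows_sub N (W : 'M[R]_(N, r)) u : (zrows W u <= W)%MS.
Proof.
apply/row_subP => i; rewrite rowK; case: eqP => _; last exact: sub0mx.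
exact: row_sub.
Qed.

(** The cokernel of [A] contains a functional that sees [v]. *)
Lemma separate_row p (A : 'M[R]_(p, r)) (v : 'rV[R]_r) :
  ~~ (v <= A)%MS -> exists2 u, A *m u = 0 & dot v u < 0.
Proof.
rewrite submxE => /rV0Pn[k vk]; pose u := col k (cokermx A).
have Au : A *m u = 0 by rewrite /u colE mulmxA mulmx_coker mul0mx.
have vu : dot v u != 0 by rewrite /dot /u colE mulmxA -colE mxE.
have [vu0|vu0] := ltP (dot v u) 0; first by exists u.
exists (- u); first by rewrite mulmxN Au oppr0.
by rewrite dotNr oppr_lt0 lt0r vu.
Qed.

(** This turns valid inequalities into facets. If the rows where [u0] vanishes,
    together with [b], do not span all rows, some functional [u1] kills them
    and is negative on another row. Moving from [u0] in the direction [u1] until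
    the first new row becomes zero keeps the value on [b], keeps every zero,
    and raises the rank of the zero rows. *)
Lemma extremal_functional (N : nat) (W : 'M[R]_(N, r)) b u0 :
  (b <= W)%MS -> (forall i, 0 <= dot (row i W) u0) -> dot b u0 < 0 ->
  exists u, [/\ forall i, 0 <= dot (row i W) u, dot b u < 0,
    forall i, dot (row i W) u0 = 0 -> dot (row i W) u = 0
    & (\rank (zrows W u)).+1 = \rank W].
Proof.
move=> bW; move: {2}(\rank W - _)%N (leqnn (\rank W - \rank (zrows W u0))) => k.
elim: k u0 => [|k IH] u0.
  rewrite leqn0 subn_eq0 => Wz Wu0 bu0; exfalso.
  have WzE : (W <= zrows W u0)%MS by rewrite -(geq_leqif (mxrank_leqif_sup (zrows_sub W u0))).
  have /submxP[D bE] := submx_trans bW WzE.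
  by move: bu0; rewrite /dot bE -mulmxA zrows_mul mulmx0 mxE ltxx.
move=> kW Wu0 bu0.
have bz : (\rank (zrows W u0)).+1 = \rank (zrows W u0 + b)%MS.
  have nb : ~~ (b <= zrows W u0)%MS.
    apply/negP => /submxP[D bE].
    by move: bu0; rewrite /dot bE -mulmxA zrows_mul mulmx0 mxE ltxx.
  apply/eqP; rewrite eqn_leq; apply/andP; split.
    by apply: rank_ltmx; rewrite ltmxE addsmxSl /= addsmx_sub submx_refl nb.
  apply: leq_trans (mxrank_adds_leqif _ _) _.
  by rewrite -[X in (_ <= X)%N]addn1 leq_add2l rank_leq_row.
have bzW : (zrows W u0 + b <= W)%MS by rewrite addsmx_sub zrows_sub.
have := mxrankS bzW; rewrite -bz leq_eqVlt => /orP[/eqP zW|zW].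
  by exists u0; split.
have /row_subPn[i0 Wi0] : ~~ (W <= zrows W u0 + b)%MS.
  by rewrite -(geq_leqif (mxrank_leqif_sup bzW)) -bz -ltnNge.
have [u1 zu1 iu1] := separate_row Wi0.
have z1 i : dot (row i W) u0 = 0 -> dot (row i W) u1 = 0.
  move=> i0z; have /submxP[D iE] : (row i W <= zrows W u0 + b)%MS.
    apply: submx_trans (addsmxSl _ _); rewrite -[row i W](_ : row i (zrows W u0) = _).
      exact: row_sub.
    by rewrite rowK i0z eqxx.
  by rewrite /dot iE -mulmxA zu1 mulmx0 mxE.
have b1 : dot b u1 = 0.
  have /submxP[D bE] : (b <= zrows W u0 + b)%MS by exact: addsmxSr.
  by rewrite /dot bE -mulmxA zu1 mulmx0 mxE.
pose neg := [pred i | dot (row i W) u1 < 0].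
pose la i := dot (row i W) u0 / - dot (row i W) u1.
(* The step length [la i1] is where the first row becomes zero. *)
have [i1 neg1 la1] : exists2 i1, neg i1 & forall i, neg i -> la i1 <= la i.
  by case: (@arg_minP _ _ _ i0 neg la iu1) => i1; exists i1.
pose u2 := u0 + la i1 *: u1.
have u2E i : dot (row i W) u2 = dot (row i W) u0 + la i1 * dot (row i W) u1.
  by rewrite /u2 dotDr dotZr.
have la1_ge0 : 0 <= la i1 by rewrite /la divr_ge0// oppr_ge0 ltW.
have u2z i : dot (row i W) u0 = 0 -> dot (row i W) u2 = 0.
  by move=> i0z; rewrite u2E i0z z1// mulr0 addr0.
have zz : (zrows W u0 < zrows W u2)%MS.
  rewrite /ltmx; apply/andP; split.
    apply/row_subP => i; rewrite rowK; case: eqP => [/u2z i2|_]; last exact: sub0mx.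
    by rewrite -[row i W](_ : row i (zrows W u2) = _) ?row_sub// rowK i2 eqxx.
  apply/negP => /(submx_trans (row_sub i1 _)).
  have -> : row i1 (zrows W u2) = row i1 W.
    suff i1z : dot (row i1 W) u2 = 0 by rewrite rowK i1z eqxx.
    by rewrite u2E /la; field; rewrite lt_eqF.
  move=> /submx_trans /(_ (addsmxSl _ b)) /submxP[D iE].
  by move: neg1; rewrite /= /dot iE -mulmxA zu1 mulmx0 mxE ltxx.
have [|||u [u_ge0 bu uz uW]] := IH u2.
- by move: (rank_ltmx zz) kW => /=; lia.
- move=> i; rewrite u2E; have [ni|] := boolP (neg i); last first.
    by rewrite /= -leNgt => i1_ge0; rewrite addr_ge0// mulr_ge0.
  have := la1 i ni; rewrite /la ler_pdivlMr ?oppr_gt0// mulrN.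
  by rewrite -subr_ge0 opprK.
- by rewrite /u2 dotDr dotZr b1 mulr0 addr0.
exists u; split=> // i /u2z; exact: uz.
Qed.
End Farkas.

(** * Toric polynomials by counting carriers *)

Section Poly.
Implicit Types (h : {poly int}).

Definition geometric n : {poly int} := \poly_(i < n) 1.

Lemma mul_geometric n : ('X - 1) * geometric n = 'X^n - 1.
Proof.
rewrite subrX1; congr (_ * _); rewrite /geometric poly_def.
by apply: eq_bigr => i _; rewrite scale1r.
Qed.

(** The h-polynomial of the boundary of a stacked ball with [k + 1] simplices of
    dimension [e]: coefficients 1, k + 1, ..., k + 1, 1. *)
Definition stacked_h (e k : nat) : {poly int} := geometric e.+1 + (geometric e - 1) *+ k.

Lemma stacked_h_unique (e k : nat) h :
  ('X - 1) * h = 'X^(e.+1) + 'X^e *+ k - (1 + 'X *+ k) -> h = stacked_h e k.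
Proof.
move=> hE; apply: (@mulfI _ ('X - 1)); first by rewrite polyXsubC_eq0.
rewrite hE /stacked_h mulrDr mulrnAr mulrBr !mul_geometric mulr1.
rewrite (_ : 'X^e - 1 - ('X - 1) = 'X^e - 'X) ?mulrnBl; last by ring.
by ring.
Qed.

Lemma stacked_h_entry (e k i : nat) : (i <= e)%N ->
  h_entry e (stacked_h e k) i = 1 + ((0 < i)%N%:R - (i == e)%N%:R) *+ k.
Proof.
move=> ie; rewrite /h_entry coefD coefMn coefB coef1 /geometric !coef_poly.
rewrite ltnS leq_subr; congr (_ + (_ - _) *+ _).
  have -> : (e - i < e)%N = (0 < i)%N && (0 < e)%N by lia.
  by case: e ie => [|e] ie; rewrite ?andbT//; case: i ie.
by congr (_%:R); congr nat_of_bool; lia.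
Qed.

Lemma stacked_g (e k : nat) : (k = 0 \/ (2 <= e))%N ->
  g_from_h e (stacked_h e k) = 1 + 'X *+ k.
Proof.
move=> ke; rewrite /g_from_h stacked_h_entry//; congr (_ + _).
  rewrite sub0r; case: ke => [->|e2]; first by rewrite addr0.
  by rewrite (_ : (0 == e) = false) ?oppr0 ?mul0rn ?addr0//; lia.
have [e2|e2] := ltnP e 2.
  have -> : k = 0%N by lia.
  by rewrite big_geq ?mulr0n//; lia.
rewrite big_ltn; last by lia.
rewrite !stacked_h_entry; [|lia..].
rewrite big1_seq => [|i]; last first.
  rewrite mem_index_iota => /andP[_ /andP[i1 i2]].
  rewrite !stacked_h_entry; [|lia..].
  have -> : (0 < i)%N = true by lia.
  have -> : (0 < i.-1)%N = true by lia.
  have -> : (i == e)%N = false by lia.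
  have -> : (i.-1 == e)%N = false by lia.
  by rewrite subrr mul0r.
have -> : (1 == e)%N = false by lia.
have -> : (1.-1 == e)%N = false by lia.
rewrite addr0 subr0 subrr mul0rn addr0 addrAC subrr add0r.
by rewrite polyCMn mulrnAl mul1r expr1.
Qed.

End Poly.

Section PowerSet.
Variables (I : finType).
Implicit Types (A B : {set I}).

(** Binomial expansion of [('X - 1) + 1]. *)
Lemma powerset_sum A : \sum_(B : {set I} | B \subset A) ('X - 1) ^+ (#|A| - #|B|) = 'X^#|A| :> {poly int}.
Proof.
transitivity (('X - 1 + 1) ^+ #|A| : {poly int}); last by rewrite subrK.
rewrite exprDn (partition_big (fun B => inord #|B| : 'I_(#|A|).+1) xpredT)//=.
apply: eq_bigr => i _; rewrite expr1n mulr1 -[X in _ *+ X]cards_draws -[X in _ *+ X]sum1_card.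
rewrite -[RHS]mulr_natr natr_sum mulr_sumr; apply: eq_big => [B|B].
  rewrite !inE; apply: andb_id2l => BA.
  by rewrite -val_eqE /= inordK ?ltnS ?subset_leq_card.
by move=> /andP[BA /eqP <-]; rewrite mulr1 inordK// ltnS subset_leq_card.
Qed.

Lemma powerset_sum1 A a : a \in A ->
  \sum_(B : {set I} | (B \subset A) && (a \in B)) ('X - 1) ^+ (#|A| - #|B|)
    = 'X^(#|A|.-1) :> {poly int}.
Proof.
move=> aA; have := powerset_sum A; rewrite (bigID (fun B => a \in B))/=.
have A1 : #|A| = #|A :\ a|.+1 by rewrite (cardsD1 a) aA.
rewrite [X in _ + X](_ : _ = ('X - 1) * \sum_(B : {set I} | B \subset A :\ a) ('X - 1) ^+ (#|A :\ a| - #|B|)).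
  rewrite powerset_sum A1 /= exprS mulrBl mul1r addrCA => /eqP.
  by rewrite -subr_eq0 addrAC subrr add0r subr_eq0 => /eqP.
rewrite mulr_sumr; apply: eq_big => [B|B]; first by rewrite subsetD1.
by move=> BA; rewrite -exprS A1 subSn// subset_leq_card// subsetD1.
Qed.

End PowerSet.

(** The properties of the face lattice of a polytope that the combinatorial part
    rests on. A face is given by its set of vertices, and its rank [rk] is its
    dimension plus one. Vertex sets with as many elements as their rank are
    simplices. The coatom clause, for a vertex [i] outside [A], yields both
    that the lattice is graded and that faces are intersections of facets. *)
Record graded_lattice (I : finType) (L : {set {set I}}) (rk : {set I} -> nat) : Prop := {
  lattice_full : [set: I] \in L;
  lattice_empty : finset.set0 \in L;
  lattice_meet : forall A B : {set I}, A \in L -> B \in L -> A :&: B \in L;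
  lattice_rk : forall A B : {set I}, A \in L -> B \in L -> A \proper B -> (rk A < rk B)%N;
  lattice_coatom : forall (A P : {set I}) i, A \in L -> P \in L -> A \subset P ->
    i \in P -> i \notin A ->
    exists C, [/\ C \in L, A \subset C, C \subset P, i \notin C & (rk C).+1 = rk P];
  lattice_simplex : forall A B : {set I}, A \in L -> rk A = #|A| -> B \subset A ->
    B \in L /\ rk B = #|B| }.

(** The recursion for the toric g-polynomial, read on the lattice. *)
Definition toric_rec (I : finType) (L : {set {set I}}) (rk : {set I} -> nat)
    (g : {set I} -> {poly int}) :=
  g finset.set0 = 1 /\
  forall A : {set I}, A \in L -> A != finset.set0 -> g A =
    g_from_h (rk A).-1 (\sum_(B : {set I} | (B \in L) && (B \proper A)) g B * ('X - 1) ^+ (rk A - 1 - rk B)).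

Section Carrier.
Variables (I : finType) (L : {set {set I}}) (rk : {set I} -> nat).
Variables (g : {set I} -> {poly int}).
Hypotheses (GL : graded_lattice L rk) (TR : toric_rec L rk g).
Implicit Types (A B C P s : {set I}) (D : {set {set I}}).

Local Notation y := ('X - 1 : {poly int}).

(** The smallest face that contains [s]. *)
Definition carrier s : {set I} := \bigcap_(B : {set I} | (B \in L) && (s \subset B)) B.

Lemma carrier_lat s : carrier s \in L.
Proof.
rewrite /carrier; elim/big_ind: _ => [|A B|B /andP[]//]; first exact: lattice_full GL.
exact: lattice_meet GL _ _.
Qed.

Lemma sub_carrier s : s \subset carrier s.
Proof. by apply/finset.bigcapsP => B /andP[]. Qed.

Lemma carrier_min s B : B \in L -> (carrier s \subset B) = (s \subset B).
Proof.
move=> BL; apply/idP/idP => [|sB]; first by apply: fintype.subset_trans; exact: sub_carrier.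
by apply: finset.bigcap_inf; rewrite BL.
Qed.

Lemma carrier_id A : A \in L -> carrier A = A.
Proof. by move=> AL; apply/eqP; rewrite finset.eqEsubset carrier_min// subxx sub_carrier. Qed.

(** For a ball triangulated by [D], this is its h-polynomial read backwards: the
    simplices carried by [A] itself are the interior ones. *)
Definition carrier_poly D A : {poly int} := \sum_(s in D | carrier s == A) y ^+ (rk A - #|s|).

(** The bound on cardinals keeps the truncated exponents of [carrier_poly] exact. *)
Definition carrier_formula D A := g A = carrier_poly D A /\
  forall s, s \in D -> carrier s = A -> (#|s| <= rk A)%N.

(** Group the simplices of the boundary of [P] by their carriers. *)
Lemma carrier_sum D P : P \in L ->
  (forall A, A \in L -> A \proper P -> carrier_formula D A) ->
  \sum_(B : {set I} | (B \in L) && (B \proper P)) g B * y ^+ (rk P - 1 - rk B) =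
  \sum_(s in D | carrier s \proper P) y ^+ (rk P - 1 - #|s|).
Proof.
move=> PL gD; rewrite [RHS](partition_big carrier [pred B : {set I} | (B \in L) && (B \proper P)])/=; last first.
  by move=> s /andP[_ ->]; rewrite carrier_lat.
apply: eq_bigr => B /andP[BL BP]; have [-> cD] := gD _ BL BP.
rewrite /carrier_poly mulr_suml; apply: eq_big => [s|s /andP[sD /eqP sB]].
  by rewrite -andbA; congr (_ && _); case: eqP => [->|]; rewrite ?BP ?andbF.
rewrite -exprD; congr (_ ^+ _).
by have := cD _ sD sB; have := lattice_rk GL BL PL BP; lia.
Qed.

(** Every subset of a simplex is a face with [g = 1], by induction, so
    ['X - 1] times the h-polynomial is [powerset_sum] without its top term. *)
Lemma simplex_g A : A \in L -> rk A = #|A| -> g A = 1.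
Proof.
case: TR => g0 gE; move: {2}#|A| (leqnn #|A|) => k.
elim: k A => [|k IH] A Ak AL rA.
  by move: Ak; rewrite leqn0 cards_eq0 => /eqP ->.
have [->//|A0] := eqVneq A finset.set0.
have A_gt0 : (0 < #|A|)%N by rewrite card_gt0.
rewrite gE//; set h := \sum_(B : {set I} | _) _.
suff -> : h = stacked_h (rk A).-1 0 by rewrite stacked_g ?mulr0n ?addr0//; left.
apply: stacked_h_unique; rewrite !mulr0n !addr0 rA prednK//.
have hE : h = \sum_(B : {set I} | B \proper A) y ^+ (#|A| - 1 - #|B|).
  apply: eq_big => [B|B /andP[BL BA]].
    apply/andb_idl => /proper_sub BA; exact: (lattice_simplex GL AL rA BA).1.
  have [_ rB] := lattice_simplex GL AL rA (proper_sub BA).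
  rewrite IH ?mul1r ?rA ?rB//.
  by have := proper_card BA; lia.
rewrite hE -(powerset_sum A) [in RHS](bigD1 A)//= subnn expr0 addrC addrK mulr_sumr.
apply: eq_big => [B|B /proper_card BA]; first by rewrite finset.properEneq andbC.
by rewrite -exprS; congr (_ ^+ _); lia.
Qed.

Lemma simplex_carrier_formula D P A : P \in L -> rk P = #|P| ->
  (forall s, s \subset P -> s \in D) -> A \subset P -> carrier_formula D A.
Proof.
move=> PL rP PD AP; have [AL rA] := lattice_simplex GL PL rP AP.
rewrite /carrier_formula (simplex_g AL rA); split; last first.
  by move=> s sD sA; rewrite rA subset_leq_card// -sA sub_carrier.
have clA s : (s \in D) && (carrier s == A) = (s == A).
  apply/andP/eqP => [[sD /eqP sA]|->]; last by rewrite PD ?carrier_id.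
  have sP : s \subset P by apply: fintype.subset_trans AP; rewrite -sA sub_carrier.
  by rewrite -sA carrier_id//; exact: (lattice_simplex GL PL rP sP).1.
by rewrite /carrier_poly (eq_bigl _ _ clA) big_pred1_eq rA subnn expr0.
Qed.

Lemma carrier_formula_eq (D D' : {set {set I}}) C A :
  (forall s, s \subset C -> (s \in D) = (s \in D')) -> A \subset C ->
  carrier_formula D A -> carrier_formula D' A.
Proof.
move=> DD AC.
have DA s : carrier s = A -> (s \in D) = (s \in D').
  by move=> sA; apply: DD; apply: fintype.subset_trans AC; rewrite -sA sub_carrier.
move=> [gA cA]; split; last by move=> s sD' sA; apply: cA => //; rewrite DA.
rewrite gA; apply: eq_bigl => s; case: eqP => [/DA ->//|_]; by rewrite !andbF.
Qed.

(** The induction step of the toric computation. By [carrier_sum], ['X - 1] times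
    the h-polynomial of [P] is the sum over all simplices of [D] in [P] minus the
    sum over the interior ones. These two sums determine h, hence g, and the g so
    obtained is again the sum over the interior simplices. *)
Lemma stacked_step D P k : P \in L -> P != finset.set0 ->
  (k = 0 \/ 3 <= rk P)%N ->
  (forall A, A \in L -> A \proper P -> carrier_formula D A) ->
  (forall s, s \in D -> s \subset P -> (#|s| <= rk P)%N) ->
  \sum_(s in D | s \subset P) y ^+ (rk P - #|s|) = 'X^(rk P) + 'X^((rk P).-1) *+ k ->
  carrier_poly D P = 1 + 'X *+ k ->
  carrier_formula D P /\
  \sum_(B : {set I} | (B \in L) && (B \proper P)) g B * y ^+ (rk P - 1 - rk B) = stacked_h (rk P).-1 k.
Proof.
move=> PL P0 kP gD cP sumD sumI.
have rP_gt0 : (0 < rk P)%N.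
  by apply: leq_ltn_trans (lattice_rk GL (lattice_empty GL) PL _); rewrite ?finset.proper0.
have hE : \sum_(B : {set I} | (B \in L) && (B \proper P)) g B * y ^+ (rk P - 1 - rk B)
    = stacked_h (rk P).-1 k.
  apply: stacked_h_unique; rewrite prednK// (carrier_sum PL gD) -sumD -sumI.
  rewrite [X in _ = X - _](bigID (fun s => carrier s == P))/=.
  rewrite [X in _ = X + _ - _](_ : _ = carrier_poly D P); last first.
    rewrite /carrier_poly; apply: eq_bigl => s; rewrite -andbA; congr (_ && _).
    by apply/andb_idl => /eqP <-; exact: sub_carrier.
  rewrite [carrier_poly D P + _]addrC addrK mulr_sumr; apply: eq_big => [s|s /andP[sD sP]].
    by rewrite finset.properEneq carrier_min// -[RHS]andbA [(_ != _) && _]andbC.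
  have := lattice_rk GL (carrier_lat s) PL sP.
  have := (gD _ (carrier_lat s) sP).2 _ sD erefl.
  by rewrite -exprS => ? ?; congr (_ ^+ _); lia.
split=> //; split; last by move=> s sD sP; rewrite cP// -sP sub_carrier.
rewrite (TR.2 _ PL P0) hE sumI stacked_g//.
by case: kP; [left|right; lia].
Qed.

End Carrier.

(** * Positions in the vertex array *)

Section Positions.
Local Open Scope nat_scope.

Definition posT (d i t : nat) := i <= t < i + d.
(** The disjunct [j == n] accounts for the convention x_t = x_n for t >= n: it puts
    x_n in E_n. Truncated subtraction, with [t == 0], does the same for x_0. *)
Definition posE (d n j t : nat) :=
  (t == 0) || (j - (d - 2) <= t <= j + (d - 2)) && ((t != j) || (j == n)).
Definition posJ (i k t : nat) := (t == 0) || (i <= t < i + k).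

(** Let lo and hi be the extreme positive positions of [tau]. A position missing
    strictly between them, or just after hi when hi - lo is small, would place
    [tau] inside the corresponding E_j; so [tau] is an interval of length [d] or
    [d - 1], and the length [d - 1] cannot start at 1, where T_0 contains it. *)
Lemma window_interior (d n : nat) (tau : pred nat) : 3 <= d <= n ->
  (forall a b, 0 < a <= n -> b <= n -> tau a -> tau b -> b < a + d) ->
  (forall i, i <= n - d + 1 -> exists t, [/\ t <= n, tau t & ~~ posT d i t]) ->
  (forall j, 2 <= j <= n -> exists t, [/\ t <= n, tau t & ~~ posE d n j t]) ->
  exists i k, [/\ 0 < i, i + d <= n.+1, k = d \/ k = d - 1 /\ 1 < i
    & forall t, t <= n -> tau t = posJ i k t].
Proof.
move=> dn win nT nE.
have [t0 [t0n tt0 t0_gt0]] : exists t, [/\ t <= n, tau t & 0 < t].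
  have [|t [tn tt nt]] := nT 0; first by [].
  by exists t; split=> //; move: nt; rewrite /posT; lia.
pose q := [pred t | [&& 0 < t, t <= n & tau t]].
have exq : exists t, q t by exists t0; rewrite /= tt0 t0n t0_gt0.
have bdq t : q t -> t <= n by case/and3P.
case: (ex_minnP exq) => lo /and3P[lo_gt0 lo_n tlo] lomin.
case: (ex_maxnP exq bdq) => hi /and3P[hi_gt0 hi_n thi] himax.
have lohi t : t <= n -> tau t -> 0 < t -> lo <= t <= hi.
  by move=> tn tt t_gt0; rewrite lomin ?himax//= ?t_gt0 ?tn.
have hilo : hi < lo + d by apply: win; rewrite ?lo_gt0.
have tau0 : tau 0.
  have [|t [tn tt]] := nT (minn lo (n - d + 1)); first by lia.
  have [tz|t0'] := posnP t; first by rewrite -tz.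
  by have := lohi _ tn tt t0'; rewrite /posT; lia.
have full t : lo <= t <= hi -> tau t.
  move=> lth; apply: contraT => ntt.
  have tlo' : t != lo by apply: contraNneq ntt => ->.
  have thi' : t != hi by apply: contraNneq ntt => ->.
  have [|s [sn ts]] := nE t; first by lia.
  have st : s != t by apply: contraNneq ntt => <-.
  have [->|s0] := posnP s; first by rewrite /posE.
  by have := lohi _ sn ts s0; rewrite /posE; lia.
have hid : d <= hi.
  have [|s [sn ts]] := nT 0; first by [].
  have [->|s0] := posnP s; first by rewrite /posT; lia.
  by have := lohi _ sn ts s0; rewrite /posT; lia.
have lod : lo + d <= n.+1.
  have [|s [sn ts]] := nE n; first by lia.
  have [->|s0] := posnP s; first by rewrite /posE.
  by have := lohi _ sn ts s0; rewrite /posE; lia.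
have big : lo + d <= hi + 2.
  have [->|hin] := eqVneq hi n; first by lia.
  have [|s [sn ts]] := nE hi.+1; first by lia.
  have [->|s0] := posnP s; first by rewrite /posE.
  by have := lohi _ sn ts s0; rewrite /posE; lia.
exists lo, (hi.+1 - lo); split=> //; first by lia.
move=> t tn; rewrite /posJ; have [->|t_gt0] := posnP t; first by rewrite tau0.
apply/idP/idP => [/(lohi _ tn)/(_ t_gt0)|]; first by lia.
by move=> h; apply: full; lia.
Qed.

(** Position 0 excludes every T_i with i > 0, and the last position excludes T_0. *)
Lemma interior_notT (d n i k i' : nat) : 3 <= d <= n -> 0 < i -> i + d <= n.+1 ->
  k = d \/ k = d - 1 /\ 1 < i -> exists t, [/\ t <= n, posJ i k t & ~~ posT d i' t].
Proof.
move=> dn i0 idn ik; have [i'0|i'0] := posnP i'; last by exists 0; rewrite /posJ /posT; split; lia.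
by exists (i + k - 1); rewrite /posJ /posT; split; lia.
Qed.

(** Besides x_0, E_j contains neither x_j, unless j = n, nor a position further than
    d - 2 from j, whereas the window spans d - 1 or d positions. *)
Lemma interior_notE (d n i k j : nat) : 3 <= d <= n -> 0 < i -> i + d <= n.+1 ->
  k = d \/ k = d - 1 /\ 1 < i -> 2 <= j <= n ->
  exists t, [/\ t <= n, posJ i k t & ~~ posE d n j t].
Proof.
move=> dn i0 idn ik jn.
have [ij|ij] := ltnP j i; first by exists (i + k - 1); rewrite /posJ /posE; split; lia.
have [ji|ji] := ltnP j (i + k); last by exists i; rewrite /posJ /posE; split; lia.
have [jn'|jn'] := eqVneq j n; last by exists j; rewrite /posJ /posE; split; lia.
by exists i; rewrite /posJ /posE; split; lia.
Qed.

Lemma posE_lin d n j t : 2 <= d -> posE d n j t =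
  (t == 0) || [&& j + 2 <= t + d, t + 2 <= j + d & (t != j) || (j == n)].
Proof.
move=> d2; rewrite /posE -andbA leq_subLR; congr (_ || _).
by congr [&& _, _ & _]; apply/idP/idP; lia.
Qed.

End Positions.

(** The positive positions of E_j are those of the interval [[hole_lo, hole_hi]]
    other than j. Renumbering them consecutively, by [skip] and its inverse
    [unskip], turns E_j into the vertex array of a braxtope of dimension d - 1 with
    last position [hole_hi - hole_lo]. *)
Section Holes.
Local Open Scope nat_scope.
Variables (d n j : nat).
Hypotheses (dn : 4 <= d <= n) (jn : 2 <= j < n).

Definition hole_lo := maxn 1 (j + 2 - d).
Definition hole_hi := minn n (j + d - 2).

Definition skip (t : nat) := if t == 0 then 0 else if hole_lo + t - 1 < j then hole_lo + t - 1 else hole_lo + t.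
Definition unskip (u : nat) := if u == 0 then 0 else if u < j then u.+1 - hole_lo else u - hole_lo.

Lemma hole_loP : hole_lo = 1 /\ j < d \/ hole_lo + d = j + 2 /\ 1 < hole_lo.
Proof. by rewrite /hole_lo; lia. Qed.

Lemma hole_hiP : hole_hi = n /\ n + 2 <= j + d \/ hole_hi + 2 = j + d /\ hole_hi < n.
Proof. by rewrite /hole_hi; lia. Qed.

Ltac bounds := have [[? ?]|[? ?]] := hole_loP; have [[? ?]|[? ?]] := hole_hiP.

Lemma hole_size : d - 1 <= hole_hi - hole_lo.
Proof. by bounds; lia. Qed.

Lemma skipP t : t <= hole_hi - hole_lo ->
  [/\ skip t <= n, posE d n j (skip t) & unskip (skip t) = t].
Proof.
have [->//|t0] := posnP t; rewrite /skip /posE gtn_eqF//.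
case: ltnP => tj tn; split; try by bounds; lia.
  by rewrite /unskip tj; case: eqP; bounds; lia.
rewrite /unskip; have -> : (hole_lo + t < j) = false by lia.
by case: eqP; bounds; lia.
Qed.

Lemma unskipP u : u <= n -> posE d n j u -> skip (unskip u) = u /\ unskip u <= hole_hi - hole_lo.
Proof.
have [->//|u0] := posnP u; rewrite /unskip /posE gtn_eqF//= => un uE.
case: ltnP => uj; split; try by bounds; lia.
  rewrite /skip; have -> : (u.+1 - hole_lo == 0) = false by bounds; lia.
  by have -> : hole_lo + (u.+1 - hole_lo) - 1 = u by [bounds; lia]; rewrite uj.
rewrite /skip; have -> : (u - hole_lo == 0) = false by bounds; lia.
have -> : hole_lo + (u - hole_lo) = u by bounds; lia.
by have -> : (u - 1 < j) = false by bounds; lia.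
Qed.

Lemma hole_sizeE : (hole_hi - hole_lo) + hole_lo = hole_hi.
Proof. by bounds; lia. Qed.

Lemma unskip_spec u : u <= n -> posE d n j u -> 0 < u ->
  0 < unskip u /\ (u < j /\ unskip u + hole_lo = u.+1 \/ j < u /\ unskip u + hole_lo = u).
Proof.
move=> un; rewrite posE_lin /unskip; last by lia.
by case: posnP => //= u0 uE _; case: (ltnP u j) => uj; bounds; lia.
Qed.

Lemma skip_spec k : 0 < k ->
  0 < skip k /\ (skip k < j /\ skip k + 1 = k + hole_lo \/ j < skip k /\ skip k = k + hole_lo).
Proof.
move=> k0; rewrite /skip gtn_eqF//.
by case: (ltnP (hole_lo + k - 1) j) => kj; bounds; lia.
Qed.

(** A window of d - 1 positions of E_j cannot fit on one side of j, so it comes from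
    a window of d positions around j. *)
Lemma skip_T k u : u <= n -> 0 < k <= (hole_hi - hole_lo) - (d - 1) + 1 -> posE d n j u ->
  posT (d - 1) k (unskip u) = posT d (hole_lo + k - 1) u.
Proof.
move=> un kn uE; have [->|u0] := posnP u; first by rewrite /posT /unskip /=; bounds; lia.
have [v0 vE] := unskip_spec un uE u0; move: (unskip u) vE v0 => v vE v0.
move: uE hole_sizeE kn; rewrite posE_lin /posT; last by lia.
by move: (hole_hi - hole_lo) => n'; bounds; case: vE => -[? ?] *; apply/idP/idP; lia.
Qed.

(** For j > d the first window is what E_j shares with the facet whose missing
    position j + 1 - d lies just before the interval. *)
Lemma skip_T0 u : u <= n -> posE d n j u ->
  posT (d - 1) 0 (unskip u) = if j <= d then posT d 0 u else posE d n (j + 1 - d) u.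
Proof.
move=> un uE; have [->|u0] := posnP u; first by rewrite /posT /posE /unskip /=; case: ifP; lia.
have [v0 vE] := unskip_spec un uE u0; move: (unskip u) vE v0 => v vE v0.
move: uE; rewrite !posE_lin /posT; [|lia..].
by case: (leqP j d) => ?; bounds; case: vE => -[? ?] *; apply/idP/idP; lia.
Qed.

(** Beyond j the renumbering gains the unit by which d - 2 exceeds d - 3; on the
    side of the missing vertex neither distance bound excludes anything. *)
Lemma skip_E k u : u <= n -> 2 <= k < hole_hi - hole_lo -> posE d n j u ->
  posE (d - 1) (hole_hi - hole_lo) k (unskip u) = posE d n (skip k) u.
Proof.
move=> un kn uE; have [->//|u0] := posnP u.
have [v0 vE] := unskip_spec un uE u0; move: (unskip u) vE v0 => v vE v0.
have [|k0 kE] := @skip_spec k; first by lia.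
move: (skip k) kE k0 => w wE w0.
move: uE hole_sizeE kn; rewrite !posE_lin; [|lia..].
rewrite (gtn_eqF u0) (gtn_eqF v0) /=; move: (hole_hi - hole_lo) => n'.
by bounds; case: vE => -[? ?]; case: wE => -[? ?] *; apply/idP/idP; lia.
Qed.

(** The partner is the facet whose missing position lies just after the interval,
    or E_n when the interval is cut off by n. *)
Lemma skip_En u : u <= n -> posE d n j u ->
  posE (d - 1) (hole_hi - hole_lo) (hole_hi - hole_lo) (unskip u) = posE d n (minn n (j + d - 1)) u.
Proof.
move=> un uE; have [->//|u0] := posnP u.
have [v0 vE] := unskip_spec un uE u0; move: (unskip u) vE v0 => v vE v0.
move: uE hole_sizeE; rewrite !posE_lin; [|lia..].
rewrite (gtn_eqF u0) (gtn_eqF v0) /=; move: (hole_hi - hole_lo) => n'; rewrite eqxx orbT andbT.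
case: (leqP n (j + d - 1)) => ?; bounds; case: vE => -[? ?] *; apply/idP/idP; lia.
Qed.

(** The window index is clamped so that the window stays inside the array. *)
Lemma meet_T i : i <= n - d + 1 -> exists2 k, k <= (hole_hi - hole_lo) - (d - 1) + 1 &
  forall u, u <= n -> posE d n j u -> posT d i u -> posT (d - 1) k (unskip u).
Proof.
move=> idn; have := hole_sizeE; move: (hole_hi - hole_lo) => n' n'E.
have [->|i0] := posnP i.
  exists 0 => // u un uE; have [->|u0] := posnP u; first by rewrite /posT /unskip /=; lia.
  have [v0 vE] := unskip_spec un uE u0; move: (unskip u) vE v0 => v vE v0.
  move: uE; rewrite !posE_lin /posT; [|lia..].
  by bounds; case: vE => -[? ?] *; lia.
exists (minn (n' - (d - 1) + 1) (maxn 1 (i + 1 - hole_lo))); first by lia.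
move=> u un uE; have [->|u0] := posnP u; first by rewrite /posT /unskip /=; lia.
have [v0 vE] := unskip_spec un uE u0; move: (unskip u) vE v0 => v vE v0.
move: uE; rewrite !posE_lin /posT; [|lia..].
by bounds; case: vE => -[? ?] *; lia.
Qed.

(** If j' lies strictly inside the interval, E_j' becomes the facet missing the same
    vertex; otherwise the intersection is contained in the first window or in
    the last facet. *)
Lemma meet_E j' : 2 <= j' <= n -> j' != j ->
  (forall u, u <= n -> posE d n j u -> posE d n j' u -> posT (d - 1) 0 (unskip u)) \/
  (exists2 k, 2 <= k <= hole_hi - hole_lo &
    forall u, u <= n -> posE d n j u -> posE d n j' u -> posE (d - 1) (hole_hi - hole_lo) k (unskip u)).
Proof.
move=> j'n j'j; have [jlo|jlo] := leqP j' hole_lo.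
  left=> u un uE; have [->|u0] := posnP u; first by rewrite /posT /unskip /=; lia.
  have [v0 vE] := unskip_spec un uE u0; move: (unskip u) vE v0 => v vE v0.
  move: uE; rewrite !posE_lin /posT; [|lia..].
  by bounds; case: vE => -[? ?] *; lia.
right; have [jhi|jhi] := leqP hole_hi j'.
  exists (hole_hi - hole_lo); first by have := hole_size; bounds; lia.
  move=> u un uE; have [->//|u0] := posnP u.
  have [v0 vE] := unskip_spec un uE u0; move: (unskip u) vE v0 => v vE v0.
  move: uE hole_sizeE; rewrite !posE_lin; [|lia..].
  rewrite (gtn_eqF u0) (gtn_eqF v0) /=; move: (hole_hi - hole_lo) => n'; rewrite eqxx orbT andbT.
  by bounds; case: vE => -[? ?] *; lia.
have jE : posE d n j j' by rewrite posE_lin; bounds; lia.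
have [||v0 vE] := @unskip_spec j' _ jE; [lia..|].
have [|js jh] := unskipP _ jE; first by lia.
have kn : 2 <= unskip j' < hole_hi - hole_lo.
  have := hole_sizeE; move: (unskip j') (hole_hi - hole_lo) vE => v n' vE.
  by bounds; case: vE => -[? ?] *; lia.
exists (unskip j'); first by lia.
by move=> u un uj uj'; rewrite skip_E ?js.
Qed.

(** Two positions of E_j on different sides of j lose one unit of distance, while
    two on the same side are close enough for both bounds to hold. *)
Lemma skip_window a b : 0 < a <= hole_hi - hole_lo -> b <= hole_hi - hole_lo ->
  (skip b < skip a + d) = (b < a + (d - 1)).
Proof.
move=> ah bh; have [->|b0] := posnP b; first by have -> : skip 0 = 0 by []; lia.
have [|a0 aE] := @skip_spec a; first by lia.
have [b0' bE] := skip_spec b0.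
move: hole_sizeE ah bh; move: (skip a) (skip b) (hole_hi - hole_lo) aE bE => p q n' aE bE.
by bounds; case: aE => -[? ?]; case: bE => -[? ?] *; apply/idP/idP; lia.
Qed.

Lemma skip0 t : (0 < skip t) = (0 < t).
Proof. by have [->//|/skip_spec[-> _]] := posnP t. Qed.

End Holes.

Section Array.
Local Open Scope nat_scope.
Variables (I : finType) (n : nat) (phi : nat -> I).
Hypothesis phi_inj : forall s t, s <= n -> t <= n -> phi s = phi t -> s = t.
Implicit Types (tau : pred nat) (s A : {set I}).

Definition img (tau : pred nat) : {set I} := [set phi (val t) | t in [pred t : 'I_n.+1 | tau t]].

Lemma imgP tau i : reflect (exists2 t, t <= n /\ tau t & i = phi t) (i \in img tau).
Proof.
apply: (iffP imsetP) => [[t tt ->]|[t [tn tt] ->]].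
  by exists t => //; split=> //; rewrite -ltnS.
by exists (Ordinal (tn : t < n.+1)).
Qed.

Lemma mem_img tau t : t <= n -> (phi t \in img tau) = tau t.
Proof.
move=> tn; apply/imgP/idP => [[s [sn ts] /(phi_inj tn sn) ->//]|tt].
by exists t.
Qed.

Lemma img_sub tau s : reflect (forall t, t <= n -> tau t -> phi t \in s) (img tau \subset s).
Proof.
apply: (iffP fintype.subsetP) => [h t tn tt|h i /imgP[t [tn tt] ->]]; last exact: h.
by apply: h; rewrite mem_img.
Qed.

Lemma eq_img tau tau' : (forall t, t <= n -> tau t = tau' t) -> img tau = img tau'.
Proof.
by move=> tt; apply/setP => i; apply/imgP/imgP => -[t [tn h] ->]; exists t => //; rewrite ?tt// -tt.
Qed.

Lemma img_pre s : s \subset img xpredT -> s = img (fun t => phi t \in s).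
Proof.
move=> sP; apply/setP => i; apply/idP/imgP => [is_|[t [_ ts] ->//]].
have /imgP[t [tn _] it] := fintype.subsetP sP _ is_.
by exists t => //; rewrite -it.
Qed.

Lemma card_interval i k : i + k <= n.+1 -> #|img (fun t => i <= t < i + k)| = k.
Proof.
elim: k => [|k IH] ik.
  by apply: eq_card0 => j; apply/imgP => -[t [_ h] _]; lia.
rewrite -[in RHS]IH; last by lia.
transitivity #|phi (i + k) |: img (fun t => i <= t < i + k)|.
  congr #|pred_of_set _|; apply/setP => j; rewrite !inE.
  apply/imgP/orP => [[t [tn h] ->]|[/eqP ->|/imgP[t [tn h] ->]]].
  - have [->|tik] := eqVneq t (i + k); [by left|right].
    by rewrite mem_img//; lia.
  - by exists (i + k) => //; lia.
  - by exists t => //; lia.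
by rewrite cardsU1 mem_img ?ltnn ?andbF//; lia.
Qed.

Lemma card_cone i k : 0 < i -> i + k <= n.+1 -> #|img (posJ i k)| = k.+1.
Proof.
move=> i0 ik; rewrite -[in RHS](card_interval ik).
transitivity #|phi 0 |: img (fun t => i <= t < i + k)|.
  congr #|pred_of_set _|; apply/setP => j; rewrite !inE.
  apply/imgP/orP => [[t [tn /orP[/eqP ->|h]] ->]|[/eqP ->|/imgP[t [tn h] ->]]].
  - by left.
  - by right; rewrite mem_img.
  - by exists 0.
  - by exists t; rewrite /posJ ?h ?orbT.
by rewrite cardsU1 mem_img//= leqNgt i0.
Qed.

(** The simplices of the triangulation: apart from x_0, their vertices lie in a
    window of [d] consecutive positions. *)
Definition Delta d : {set {set I}} :=
  [set s : {set I} | (s \subset img xpredT) &&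
    [forall a : 'I_n.+1, forall b : 'I_n.+1,
      [&& 0 < a, phi a \in s & phi b \in s] ==> (b < a + d)]].

Lemma DeltaP d s : reflect (s \subset img xpredT /\ forall a b, 0 < a <= n -> b <= n ->
  phi a \in s -> phi b \in s -> b < a + d) (s \in Delta d).
Proof.
rewrite inE; apply: (iffP andP) => -[sP h]; split=> //.
  move=> a b /andP[a0 an] bn as_ bs.
  move/forallP : h => /(_ (Ordinal (an : a < n.+1)))/forallP/(_ (Ordinal (bn : b < n.+1))).
  by rewrite /= a0 as_ bs.
apply/forallP => a; apply/forallP => b; apply/implyP => /and3P[a0 as_ bs].
by apply: h as_ bs; have := ltn_ord a; have := ltn_ord b; lia.
Qed.

Lemma Delta_sub d s s' : s \subset s' -> s' \in Delta d -> s \in Delta d.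
Proof.
move=> ss /DeltaP[sP h]; apply/DeltaP; split; first exact: fintype.subset_trans sP.
by move=> a b a0 bn /(fintype.subsetP ss) ? /(fintype.subsetP ss) ?; apply: h.
Qed.

Lemma img_Delta d tau : (forall a b, 0 < a <= n -> b <= n -> tau a -> tau b -> b < a + d) ->
  img tau \in Delta d.
Proof.
move=> h; apply/DeltaP; split; first by apply/img_sub => t tn _; rewrite mem_img.
move=> a b a0n bn; have [_ an] := andP a0n; rewrite !mem_img//; exact: h.
Qed.

(** Start the window at the least positive position, moved back if it would run
    past the end of the array. *)
Lemma Delta_cone d s : d <= n -> s \in Delta d ->
  exists2 i, 0 < i /\ i + d <= n.+1 & s \subset img (posJ i d).
Proof.
move=> dn /DeltaP[sP h]; rewrite (img_pre sP).
have [[t0 [t0n st0]]|nt] := pselect (exists t, 0 < t <= n /\ phi t \in s); last first.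
  exists 1; first by lia.
  apply/img_sub => t tn ts; rewrite mem_img// /posJ; case: posnP => //= t0.
  by case: nt; exists t; rewrite t0.
pose q := [pred t | (0 < t <= n) && (phi t \in s)].
have exq : exists t, q t by exists t0; rewrite /= t0n.
case: (ex_minnP exq) => lo /andP[lo0 tlo] lomin.
exists (minn lo (n.+1 - d)); first by lia.
apply/img_sub => t tn ts; rewrite mem_img// /posJ; case: (posnP t) => //= tpos.
have : lo <= t by apply: lomin; rewrite /= tpos tn.
by have := h _ _ lo0 tn tlo ts; lia.
Qed.

Lemma Delta_card d s : d <= n -> s \in Delta d -> #|s| <= d.+1.
Proof.
move=> dn /(Delta_cone dn)[i [i0 idn] /subset_leq_card].
by rewrite card_cone.
Qed.

Local Open Scope ring_scope.

(** Add the vertices one at a time: the simplices with last vertex [k + 1 > d] are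
    the subsets containing it of a single cone, which contribute ['X^d]. *)
Lemma Delta_sum d : (0 < d)%N -> (d <= n)%N ->
  \sum_(s in Delta d) ('X - 1) ^+ (d.+1 - #|s|) = 'X^(d.+1) + 'X^d *+ (n - d) :> {poly int}.
Proof.
move=> d0 dn.
pose D k := \sum_(s in Delta d | s \subset img (fun t => t <= k)%N)
  (('X - 1) ^+ (d.+1 - #|s|) : {poly int}).
suff DE k : (d <= k <= n)%N -> D k = 'X^(d.+1) + 'X^d *+ (k - d).
  rewrite -DE ?dn ?leqnn// /D; apply: eq_bigl => s; apply/esym/andb_idr => /DeltaP[sP _].
  apply: fintype.subset_trans sP _; apply/img_sub => t tn _; by rewrite mem_img.
elim: k => [|k IH] dk; first by lia.
have [dk'|kd] := ltnP d k.+1; last first.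
  have -> : k.+1 = d by lia.
  rewrite subnn addr0 /D.
  have cd : #|img (posJ 1 d)| = d.+1 by rewrite card_cone//; lia.
  have JE : img (posJ 1 d) = img (fun t => t <= d)%N.
    by apply: eq_img => t tn; rewrite /posJ; lia.
  rewrite -cd -(powerset_sum (img _)); apply: eq_bigl => s; rewrite JE.
  apply/andb_idl => sd; apply: Delta_sub sd _; apply: img_Delta => a b; lia.
rewrite /D (bigID (fun s => phi k.+1 \in s))/= addrC.
have -> : 'X^(d.+1) + 'X^d *+ (k.+1 - d) = D k + 'X^d.
  by rewrite IH ?subSn ?mulrSr ?addrA//; lia.
congr (_ + _).
  apply: eq_bigl => s; rewrite -andbA; congr (_ && _); apply/andP/idP => [[sk nk]|sk].
    apply/fintype.subsetP => i is_; have /imgP[t [tn tk] it] := fintype.subsetP sk _ is_.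
    rewrite it mem_img//; move: tk; rewrite leq_eqVlt => /orP[/eqP tk|//].
    by case/negP: nk; rewrite -tk -it.
  split; first by apply: fintype.subset_trans sk _; apply/img_sub => t tn tk; rewrite mem_img//; lia.
  by apply: contraTN sk => ks; apply/negP => /fintype.subsetP/(_ _ ks); rewrite mem_img ?ltnn//; lia.
pose A := img (posJ (k.+2 - d) d).
have cA : #|A| = d.+1 by rewrite card_cone//; lia.
have kA : phi k.+1 \in A by rewrite mem_img /posJ; lia.
rewrite -[X in 'X^X]/(d.+1.-1) -cA -(powerset_sum1 kA); apply: eq_bigl => s.
apply/andP/andP => [[/andP[/DeltaP[sP h] sk] ks]|[sA ks]]; split=> //.
  apply/fintype.subsetP => i is_; have /imgP[t [tn tk] it] := fintype.subsetP sk _ is_.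
  rewrite it in is_ *; rewrite mem_img// /posJ; case: posnP => //= t0.
  by have := h t k.+1 _ _ is_ ks; lia.
have AD : A \in Delta d by apply: img_Delta => a b; rewrite /posJ; lia.
rewrite (Delta_sub sA AD) /=; apply: fintype.subset_trans sA _.
by apply/img_sub => t tn; rewrite /posJ mem_img//; lia.
Qed.

End Array.

Section ArrayPos.
Local Open Scope nat_scope.
Variables (I : finType) (n : nat) (phi : nat -> I).
Hypothesis phi_inj : forall a b : nat, a <= n -> b <= n -> phi a = phi b -> a = b.
Implicit Types (tau : pred nat) (s : {set I}).

Lemma img_andb tau tau' : img n phi (fun t => tau t && tau' t) = img n phi tau :&: img n phi tau'.
Proof.
apply/setP => i; rewrite finset.in_setI; apply/imgP/andP.
  by move=> [t [tn /andP[h h']] ->]; rewrite !mem_img.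
move=> [/imgP[t [tn h] ->]]; rewrite mem_img// => h'.
by exists t => //; rewrite h.
Qed.

Lemma img_skip d j tau : 4 <= d <= n -> 2 <= j < n ->
  img (hole_hi d n j - hole_lo d j) (phi \o skip d j) tau =
  img n phi (fun u => posE d n j u && tau (unskip d j u)).
Proof.
move=> dn jn; apply/setP => i; apply/imgP/imgP => -[t [tn h] ->].
  have [sn sE sK] := skipP dn jn tn.
  by exists (skip d j t) => //; rewrite sE sK.
case/andP: h => tE tt; have [uK un] := unskipP dn jn tn tE.
by exists (unskip d j t) => //=; rewrite uK.
Qed.

Lemma posT_proper d i : 3 <= d <= n -> img n phi (posT d i) \proper img n phi xpredT.
Proof.
move=> dn; rewrite fintype.properE.
apply/andP; split; first by apply/img_sub => // t tn _; rewrite mem_img.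
apply/(img_sub phi_inj) => h; have h0 := h 0 isT isT; have hn := h n (leqnn n) isT.
by move: h0 hn; rewrite !mem_img// /posT; lia.
Qed.

Lemma posE_proper d j : 3 <= d <= n -> 2 <= j <= n ->
  img n phi (posE d n j) \proper img n phi xpredT.
Proof.
move=> dn jn; rewrite fintype.properE.
apply/andP; split; first by apply/img_sub => // t tn _; rewrite mem_img.
apply/(img_sub phi_inj) => h; have [jn'|jn'] := eqVneq j n.
  have n1 : 1 <= n by lia.
  by have := h 1 n1 isT; rewrite mem_img// /posE; lia.
have jn2 : j <= n by lia.
by have := h j jn2 isT; rewrite mem_img// /posE; lia.
Qed.

Lemma card_posT d i : 3 <= d <= n -> i <= n - d + 1 -> #|img n phi (posT d i)| = d.
Proof. by move=> dn idn; rewrite card_interval//; lia. Qed.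

Lemma card_posEn d : 3 <= d <= n -> #|img n phi (posE d n n)| = d.
Proof.
move=> dn; have -> : img n phi (posE d n n) = img n phi (posJ (n + 2 - d) (d - 1)).
  by apply: eq_img => t tn; rewrite /posE /posJ; lia.
by rewrite card_cone//; lia.
Qed.

Lemma card_posE3 j : 2 <= j < n -> #|img n phi (posE 3 n j)| = 3.
Proof.
move=> jn; have -> : img n phi (posE 3 n j) = [set phi 0; phi (j - 1); phi (j + 1)]%SET.
  apply/setP => i; rewrite !inE; apply/imgP/orP.
    move=> [t [tn tE] ->]; have [->|t0] := eqVneq t 0; first by rewrite eqxx; left.
    have [->|tj] := eqVneq t (j - 1); first by rewrite eqxx orbT; left.
    by have -> : t = j + 1 by [move: tE; rewrite /posE; lia]; right.
  by case=> [/orP[]|] /eqP ->; [exists 0|exists (j - 1)|exists (j + 1)] => //; rewrite /posE; lia.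
rewrite finset.setUC finset.cardsU1 cards2 !inE.
have inj3 (s t : nat) : s <= n -> t <= n -> s != t -> phi s != phi t.
  by move=> sn tn; apply: contra_neq; exact: phi_inj.
by rewrite (negbTE (inj3 _ _ _ _ _)) ?(negbTE (inj3 _ _ _ _ _)) ?inj3//; lia.
Qed.

Lemma Delta_posT d i s : s \subset img n phi (posT d i) -> s \in Delta n phi d.
Proof.
by move=> /Delta_sub; apply; apply: img_Delta => // a b; rewrite /posT; lia.
Qed.

Lemma Delta_posEn d s : 3 <= d <= n -> s \subset img n phi (posE d n n) -> s \in Delta n phi d.
Proof.
by move=> dn /Delta_sub; apply; apply: img_Delta => // a b; rewrite /posE; lia.
Qed.

Lemma Delta_posE3 j s : 2 <= j < n -> s \subset img n phi (posE 3 n j) -> s \in Delta n phi 3.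
Proof.
by move=> dn /Delta_sub; apply; apply: img_Delta => // a b; rewrite /posE; lia.
Qed.

(** The triangulation of the braxtope restricts to that of its facet E_j. *)
Lemma Delta_skip d j s : 4 <= d <= n -> 2 <= j < n -> s \subset img n phi (posE d n j) ->
  (s \in Delta n phi d) = (s \in Delta (hole_hi d n j - hole_lo d j) (phi \o skip d j) (d - 1)).
Proof.
move=> dn jn sE; apply/DeltaP/DeltaP => -[sP h]; split.
- rewrite img_skip//; apply: fintype.subset_trans sE _.
  by apply/img_sub => // t tn tE; rewrite mem_img// tE.
- move=> a b ah bh /= as_ bs; have /andP[a0 an] := ah.
  have [an' _ _] := skipP dn jn an; have [bn' _ _] := skipP dn jn bh.
  by rewrite -(skip_window dn jn)//; apply: h => //; rewrite (skip0 dn jn) a0.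
- by apply: fintype.subset_trans sE _; apply/img_sub => // t tn _; rewrite mem_img.
- move=> a b /andP[a0 an] bn as_ bs.
  have aE : posE d n j a by rewrite -(mem_img phi_inj)//; exact: (fintype.subsetP sE).
  have bE : posE d n j b by rewrite -(mem_img phi_inj)//; exact: (fintype.subsetP sE).
  have [aK ah] := unskipP dn jn an aE; have [bK bh] := unskipP dn jn bn bE.
  have ua0 : 0 < unskip d j a <= hole_hi d n j - hole_lo d j by rewrite ah -(skip0 dn jn) aK a0.
  have := h _ _ ua0 bh; rewrite /= aK bK => /(_ as_ bs).
  by rewrite -(skip_window dn jn)// aK bK.
Qed.

End ArrayPos.


(** * The face lattice of a braxtope *)

Section Brax.
Local Open Scope nat_scope.
Variables (I : finType) (L : {set {set I}}) (rk : {set I} -> nat).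
Variables (g : {set I} -> {poly int}).
Hypotheses (GL : graded_lattice L rk) (TR : toric_rec L rk g).
Implicit Types (A B C P s : {set I}) (phi : nat -> I).

(** [P] is a braxtope in the lattice [L] with vertices [phi 0, ..., phi n]. The T_i and
    E_j are required to be faces that include all facets; this form is inherited
    by the facets E_j without a comparison of their own T_i and E_j. *)
Record brax_array (d n : nat) phi P : Prop := {
  ba_dn : 3 <= d <= n;
  ba_inj : forall s t : nat, s <= n -> t <= n -> phi s = phi t -> s = t;
  ba_P : P = img n phi xpredT;
  ba_rk : rk P = d.+1;
  ba_L : P \in L;
  ba_T : forall i, i <= n - d + 1 -> img n phi (posT d i) \in L;
  ba_E : forall j, 2 <= j <= n -> img n phi (posE d n j) \in L;
  ba_coatom : forall C, C \in L -> C \subset P -> (rk C).+1 = rk P ->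
    (exists2 i, i <= n - d + 1 & C = img n phi (posT d i)) \/
    (exists2 j, 2 <= j <= n & C = img n phi (posE d n j)) }.

Lemma ba_T_proper d n phi P i : brax_array d n phi P -> img n phi (posT d i) \proper P.
Proof. by move=> W; rewrite (ba_P W); apply: (posT_proper (ba_inj W)); exact: (ba_dn W).
Qed.

Lemma ba_E_proper d n phi P j : brax_array d n phi P -> 2 <= j <= n ->
  img n phi (posE d n j) \proper P.
Proof. by move=> W jn; rewrite (ba_P W); apply: (posE_proper (ba_inj W)) => //; exact: (ba_dn W).
Qed.

(** A simplex lies in a proper face exactly when it lies in some T_i or E_j, so this
    is [window_interior]: the interior simplices are the cones J_i and the
    intersections of consecutive ones. *)
Lemma ba_interior d n phi P s : brax_array d n phi P -> s \in Delta n phi d ->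
  carrier L s = P <-> exists i k, [/\ 0 < i, i + d <= n.+1, k = d \/ k = d - 1 /\ 1 < i
    & s = img n phi (posJ i k)].
Proof.
move=> W sD; have inj := ba_inj W; have dn := ba_dn W.
have [sP win] := DeltaP _ _ _ _ sD; split=> [sE|[i [k [i0 idn ik sE]]]].
  have [|||i [k [i0 idn ik iE]]] := @window_interior d n (fun t => phi t \in s) dn.
  - by move=> a b a0 bn; exact: win.
  - move=> i idn; apply: contrapT => ni.
    have : s \subset img n phi (posT d i).
      rewrite {1}(img_pre sP); apply/img_sub => // t tn ts.
      by rewrite mem_img//; apply: contraT => nt; case: ni; exists t.
    rewrite -(carrier_min s (ba_T W idn)) sE; apply/negP; exact: proper_subn (ba_T_proper _ W).
  - move=> j jn; apply: contrapT => ni.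
    have : s \subset img n phi (posE d n j).
      rewrite {1}(img_pre sP); apply/img_sub => // t tn ts.
      by rewrite mem_img//; apply: contraT => nt; case: ni; exists t.
    rewrite -(carrier_min s (ba_E W jn)) sE; apply/negP; exact: proper_subn (ba_E_proper W jn).
  exists i, k; split=> //; rewrite (img_pre sP); exact: eq_img.
apply/eqP; rewrite finset.eqEsubset; apply/andP; split.
  by rewrite (carrier_min s (ba_L W)) (ba_P W).
apply/fintype.subsetP => z zP; apply: contraT => zs.
have [|C [CL sC CP zC rC]] := lattice_coatom GL (carrier_lat GL s) (ba_L W) _ zP zs.
  by rewrite (carrier_min s (ba_L W)) (ba_P W).
have {}sC : s \subset C by rewrite -(carrier_min s CL).
have [[i' _ CE]|[j jn CE]] := ba_coatom W CL CP rC.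
  have [t [tn tJ]] := @interior_notT d n i k i' dn i0 idn ik.
  have : phi t \in C by apply: (fintype.subsetP sC); rewrite sE mem_img.
  by rewrite CE mem_img// => ->.
have [t [tn tJ]] := @interior_notE d n i k j dn i0 idn ik jn.
have : phi t \in C by apply: (fintype.subsetP sC); rewrite sE mem_img.
by rewrite CE mem_img// => ->.
Qed.

Local Open Scope ring_scope.

Lemma ba_interior_sum d n phi P : brax_array d n phi P ->
  carrier_poly L rk (Delta n phi d) P = 1 + 'X *+ (n - d).
Proof.
move=> W; have inj := ba_inj W; have dn := ba_dn W.
pose J (i : 'I_(n - d).+1) := img n phi (posJ i.+1 d).
pose K (i : 'I_(n - d)) := img n phi (posJ i.+2 (d - 1)).
have cJ i : #|J i| = d.+1 by rewrite /J card_cone//; have := ltn_ord i; lia.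
have cK i : #|K i| = d by rewrite /K card_cone//; have := ltn_ord i; lia.
have iJ : injective J.
  move=> i j ij; apply/val_inj => /=; have := ltn_ord i; have := ltn_ord j => jn iN.
  have : phi i.+1 \in J j by rewrite -ij mem_img// /posJ; lia.
  have : phi j.+1 \in J i by rewrite ij mem_img// /posJ; lia.
  by rewrite !mem_img// /posJ; lia.
have iK : injective K.
  move=> i j ij; apply/val_inj => /=; have := ltn_ord i; have := ltn_ord j => jn iN.
  have : phi i.+2 \in K j by rewrite -ij mem_img// /posJ; lia.
  have : phi j.+2 \in K i by rewrite ij mem_img// /posJ; lia.
  by rewrite !mem_img// /posJ; lia.
rewrite /carrier_poly (ba_rk W).
transitivity (\sum_(s in [set J i | i : 'I_(n - d).+1] :|: [set K i | i : 'I_(n - d)])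
    (('X - 1) ^+ (d.+1 - #|s|) : {poly int})).
  apply: eq_bigl => s; rewrite finset.in_setU; apply/andP/orP => [[sD /eqP]|].
    move=> /(ba_interior W sD)[i [k [i0 idn [->|[-> i1]] ->]]].
      left; apply/imsetP; have ik : (i.-1 < (n - d).+1)%N by lia.
      by exists (Ordinal ik) => //; rewrite /J /= prednK.
    right; apply/imsetP; have ik : (i.-2 < n - d)%N by lia.
    by exists (Ordinal ik) => //; rewrite /K /=; congr img; congr posJ; lia.
  move=> H; suff [sD ?] : s \in Delta n phi d /\ exists i k, [/\ (0 < i)%N,
      (i + d <= n.+1)%N, k = d \/ k = (d - 1)%N /\ (1 < i)%N & s = img n phi (posJ i k)].
    by split=> //; apply/eqP/(ba_interior W sD).
  case: H => /imsetP[i _ ->]; have iN := ltn_ord i.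
    split; first by apply: img_Delta => // a b; rewrite /posJ; lia.
    by exists i.+1, d; split=> //; [lia|left].
  split; first by apply: img_Delta => // a b; rewrite /posJ; lia.
  by exists i.+2, (d - 1)%N; split=> //; [lia|right].
rewrite (eq_bigl [predU [set J i | i : 'I_(n - d).+1] & [set K i | i : 'I_(n - d)]]) => [|s]; last first.
  by rewrite finset.in_setU.
rewrite bigU /=; last first.
  rewrite finset.disjoints_subset; apply/fintype.subsetP => s /imsetP[i _ ->].
  rewrite inE; apply/imsetP => -[j _ ijE]; have := cJ i; rewrite ijE cK; lia.
rewrite big_imset; last by move=> i j _ _; exact: iJ.
rewrite big_imset; last by move=> i j _ _; exact: iK.
rewrite /= (eq_bigr (fun=> 1)) => [|i _]; last by rewrite cJ subnn.
rewrite [X in _ + X](eq_bigr (fun=> 'X - 1)) => [|i _]; last first.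
  by rewrite cK subSnn.
rewrite !sumr_const !card_ord mulrnBl mulrS.
by rewrite -addrA [1 *+ _ + _]addrC subrK.
Qed.

Lemma ba_step d n phi P : brax_array d n phi P ->
  (forall A, A \in L -> A \proper P -> carrier_formula L rk g (Delta n phi d) A) ->
  carrier_formula L rk g (Delta n phi d) P /\
  \sum_(B : {set I} | (B \in L) && (B \proper P)) g B * ('X - 1) ^+ (rk P - 1 - rk B)
    = stacked_h d (n - d).
Proof.
move=> W gA; have inj := ba_inj W; have dn := ba_dn W; have PL := ba_L W.
have := @stacked_step _ _ _ _ GL TR (Delta n phi d) P (n - d) PL.
rewrite (ba_rk W) /=; apply=> //.
- by apply/finset.set0Pn; exists (phi 0%N); rewrite (ba_P W) mem_img.
- by right; lia.
- by move=> s sD _; apply: Delta_card sD => //; lia.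
- rewrite -(Delta_sum inj); [|lia|lia]; apply: eq_bigl => s.
  by rewrite (ba_P W); apply: andb_idr => /DeltaP[].
- exact: ba_interior_sum.
Qed.

End Brax.

Section BraxRecursion.
Local Open Scope nat_scope.
Variables (I : finType) (L : {set {set I}}) (rk : {set I} -> nat).
Variables (g : {set I} -> {poly int}).
Hypotheses (GL : graded_lattice L rk) (TR : toric_rec L rk g).
Implicit Types (A B C P s : {set I}) (phi : nat -> I).

(** A facet of E_j is the intersection of E_j with another facet of [P]. Each such
    intersection lies in one of the T and E sets of the renumbered array, and
    these sets are themselves such intersections. *)
Lemma ba_facet d n phi P j : brax_array L rk d n phi P -> 4 <= d -> 2 <= j < n ->
  (rk (img n phi (posE d n j))).+1 = rk P ->
  brax_array L rk (d - 1) (hole_hi d n j - hole_lo d j) (phi \o skip d j) (img n phi (posE d n j)).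
Proof.
move=> W d4 jn rE; have inj := ba_inj W; have dn0 := ba_dn W.
have dn : 4 <= d <= n by lia.
have jn' : 2 <= j <= n by lia.
set n' := hole_hi d n j - hole_lo d j.
have n'd : d - 1 <= n' := hole_size dn jn.
have EL := ba_E W jn'.
set psi := phi \o skip d j.
have psi_inj (s t : nat) : s <= n' -> t <= n' -> psi s = psi t -> s = t.
  move=> sn tn /inj; have [s1 _ s2] := skipP dn jn sn; have [t1 _ t2] := skipP dn jn tn.
  by move=> /(_ s1 t1) st; rewrite -s2 -t2 st.
(* A set of the renumbered array is a face when it is the trace of one on E_j. *)
have inL tau tau' : (forall u, u <= n -> posE d n j u -> tau (unskip d j u) = tau' u) ->
    img n phi tau' \in L -> img n' psi tau \in L.
  move=> tt' tL; rewrite img_skip//.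
  suff -> : img n phi (fun u => posE d n j u && tau (unskip d j u)) =
      img n phi (posE d n j) :&: img n phi tau' by exact (lattice_meet GL EL tL).
  rewrite -img_andb//; apply: eq_img => u un.
  by apply: andb_id2l => uE; exact: tt'.
have TL k : k <= n' - (d - 1) + 1 -> img n' psi (posT (d - 1) k) \in L.
  have [->|k0] := posnP k.
    move=> _; apply: inL => [u un uE|]; first exact: (skip_T0 dn jn un uE).
    case: (leqP j d) => jd; first exact: (ba_T W (leq0n _)).
    by apply: (ba_E W (j := j + 1 - d)); lia.
  move=> kn; apply: inL => [u un uE|]; first by apply: (skip_T dn jn un _ uE); rewrite k0.
  apply: (ba_T W); have := hole_sizeE dn jn.
  by have := hole_loP dn jn; have := hole_hiP dn jn; rewrite -/n'; lia.
have EL' k : 2 <= k <= n' -> img n' psi (posE (d - 1) n' k) \in L.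
  move=> kn; have [->|kn'] := eqVneq k n'.
    apply: inL => [u un uE|]; first exact: (skip_En dn jn un uE).
    by apply: (ba_E W); lia.
  have kn2 : 2 <= k < n' by lia.
  apply: inL => [u un uE|]; first exact: (skip_E dn jn un kn2 uE).
  have [|sn _ _] := @skipP d n j dn jn k; first by rewrite -/n'; lia.
  apply: (ba_E W); have [|_ sE] := @skip_spec d n j dn jn k; first by lia.
  by have := hole_loP dn jn; have := hole_hiP dn jn; have := hole_sizeE dn jn; rewrite -/n'; lia.
have dn' : 3 <= d - 1 <= n' by lia.
have EP : img n phi (posE d n j) = img n' psi xpredT.
  by rewrite img_skip//; apply: eq_img => u un; rewrite andbT.
split=> //; first by move: rE; rewrite (ba_rk W) subn1 prednK; lia.
move=> C CL CE rC.
have [z zE zC] : exists2 z, z \in img n phi (posE d n j) & z \notin C.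
  apply/fintype.subsetPn; apply/negP => EC; have CEE : C = img n phi (posE d n j).
    by apply/eqP; rewrite finset.eqEsubset CE.
  by move: rC; rewrite CEE; lia.
have EPP : img n phi (posE d n j) \proper P by rewrite (ba_P W); exact: posE_proper.
have zP : z \in P by apply: (fintype.subsetP (proper_sub EPP)).
have CP : C \subset P by apply: fintype.subset_trans CE (proper_sub EPP).
have [G [GLa CG GP zG rG]] := lattice_coatom GL CL (ba_L W) CP zP zC.
(* [C] lies in the trace of [G], hence in a proper face of E_j from the list,
   and the ranks leave no room between them. *)
have key tau : img n' psi tau \in L -> img n' psi tau \proper img n' psi xpredT ->
    (forall u, u <= n -> posE d n j u -> phi u \in G -> tau (unskip d j u)) ->
    C = img n' psi tau.
  move=> NL NP tG; apply/eqP; apply: contraT => CN.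
  have CsN : C \proper img n' psi tau.
    rewrite finset.properEneq CN /=; apply/fintype.subsetP => i iC.
    have := fintype.subsetP CE _ iC; have := fintype.subsetP CG _ iC.
    move=> iG /imgP[u [un uE] iu]; rewrite img_skip// iu mem_img// uE /=.
    by apply: tG; rewrite // -iu.
  have NE : img n' psi tau \proper img n phi (posE d n j) by rewrite EP.
  by have := lattice_rk GL NL EL NE; rewrite -rC ltnS leqNgt (lattice_rk GL CL NL CsN).
have [[i idn GE]|[j' j'n GE]] := ba_coatom W GLa GP rG.
  have [k kn kT] := meet_T dn jn idn; left; exists k => //.
  apply: key; [exact: TL|exact: posT_proper|move=> u un uE].
  by rewrite GE mem_img//; exact: kT.
have j'j : j' != j by apply: contraNneq zG => j'j; rewrite GE j'j.
have [kT|[k kn kE]] := meet_E dn jn j'n j'j.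
  left; exists 0 => //; apply: key; [exact: TL|exact: posT_proper|move=> u un uE].
  by rewrite GE mem_img//; exact: kT.
right; exists k => //; apply: key; [exact: EL'|exact: posE_proper|move=> u un uE].
by rewrite GE mem_img//; exact: kE.
Qed.

(** Induction on the dimension through the facet that contains [A]: the facet is a
    simplex or, by [ba_facet], a braxtope of smaller dimension. *)
Lemma ba_carrier_formula d n phi P A : brax_array L rk d n phi P -> A \in L -> A \proper P ->
  carrier_formula L rk g (Delta n phi d) A.
Proof.
elim: d n phi P A => [|d IH] n phi P A W AL AP; first by have := ba_dn W.
have inj := ba_inj W; have dn := ba_dn W.
have [AsP [z zP zA]] := properP AP.
have [C [CL AC CP _ rC]] := lattice_coatom GL AL (ba_L W) AsP zP zA.
have rC' : rk C = d.+1 by move: rC; rewrite (ba_rk W) => -[].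
have [[i idn CE]|[j jn CE]] := ba_coatom W CL CP rC.
  apply: (simplex_carrier_formula GL TR CL _ _ AC).
    by rewrite rC' CE card_posT.
  by move=> s; rewrite CE; exact: Delta_posT.
have [jE|jE] := eqVneq j n.
  apply: (simplex_carrier_formula GL TR CL _ _ AC).
    by rewrite rC' CE jE card_posEn.
  by move=> s; rewrite CE jE; exact: Delta_posEn.
have jn' : 2 <= j < n by lia.
have [d3|d4] := leqP d 2.
  have d2 : d = 2 by lia.
  rewrite {}d2 in rC' CE W dn IH *.
  apply: (simplex_carrier_formula GL TR CL _ _ AC).
    by rewrite rC' CE card_posE3.
  by move=> s; rewrite CE; exact: Delta_posE3.
have rE : (rk (img n phi (posE d.+1 n j))).+1 = rk P by rewrite -CE.
have W' := ba_facet W d4 jn' rE; rewrite subn1 /= -CE in W'.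
apply: (carrier_formula_eq (D := Delta (hole_hi d.+1 n j - hole_lo d.+1 j) (phi \o skip d.+1 j) d) (C := C)) => //.
  move=> s sC; rewrite [RHS](@Delta_skip _ _ _ inj _ j)//; first by rewrite subn1.
  - by lia.
  - by rewrite -CE.
have [->|AnC] := eqVneq A C; last first.
  by apply: IH W' _ _ => //; rewrite finset.properEneq AnC.
apply: (ba_step GL TR W' _).1 => B BL BC; exact: IH W' BL BC.
Qed.

Lemma ba_toric d n phi P : brax_array L rk d n phi P ->
  (\sum_(B : {set I} | (B \in L) && (B \proper P)) g B * ('X - 1) ^+ (rk P - 1 - rk B)
    = stacked_h d (n - d))%R.
Proof. by move=> W; apply: (ba_step GL TR W _).2 => B BL BC; exact: ba_carrier_formula W BL BC. Qed.

End BraxRecursion.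

Section Shallow.
Variables (I : finType) (L : {set {set I}}) (rk : {set I} -> nat).
Hypothesis GL : graded_lattice L rk.
Variables (d n : nat) (phi : nat -> I) (P : {set I}).
Hypothesis W : brax_array L rk d n phi P.
Local Open Scope nat_scope.
Let inj := ba_inj W.
Let dn := ba_dn W.

(** Each E_h with [h] in the interior of the window drops the rank, because it
    misses x_h while the other ones contain it. *)
Lemma holes_rank i (s : seq nat) : 0 < i -> i + d <= n.+1 -> uniq s ->
  all (fun h => i < h < i + d - 1) s ->
  let A := img n phi (fun t => all (fun h => posE d n h t) s) in
  A \in L /\ rk A + size s <= d.+1.
Proof.
move=> i0 idn; elim: s => [|h s IH] /=.
  by move=> _ _; rewrite -(ba_P W) (ba_L W) (ba_rk W) addn0.
move=> /andP[hs us] /andP[ih is_].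
have {IH}[AL rA] := IH us is_.
have hn : 2 <= h <= n by lia.
rewrite img_andb//; have BL := lattice_meet GL (ba_E W hn) AL; split=> //.
suff : rk (img n phi (posE d n h) :&: img n phi (fun t => all (fun h => posE d n h t) s))
    < rk (img n phi (fun t => all (fun h => posE d n h t) s)) by lia.
apply: (lattice_rk GL) => //; rewrite fintype.properE finset.subsetIr /=.
have hn' : h <= n by lia.
apply/fintype.subsetPn; exists (phi h).
  rewrite mem_img//; apply/allP => h' h's; have /andP[? ?] := allP is_ _ h's.
  have : h' != h by apply: contraNneq hs => <-.
  by rewrite /posE; lia.
rewrite finset.in_setI mem_img//; suff -> : posE d n h h = false by [].
by rewrite /posE; lia.
Qed.

(** With k + 1 vertices including x_0, the window has at least d - 2 - k interior
    positions that are not used, and [holes_rank] gives a face of rank at most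
    k + 3, which is at most 2 k + 1 for k >= 2. For k = 1, either T_0 is a simplex
    containing both vertices, or the window can be chosen to end at the second
    one, so that all d - 2 interior positions are free. *)
Lemma shallow_carrier i (B : {set I}) : 0 < i -> i + d <= n.+1 ->
  (forall i, i <= n - d + 1 -> rk (img n phi (posT d i)) = d) ->
  (forall t, t <= n -> [set phi t]%SET \in L /\ rk [set phi t]%SET = 1) ->
  B \subset img n phi (posJ i d) -> 0 < #|B| ->
  exists A : {set I}, [/\ A \in L, B \subset A & rk A < 2 * #|B|].
Proof.
move=> i0 idn rT vL BJ B0.
have simpT i' : i' <= n - d + 1 -> B \subset img n phi (posT d i') ->
    exists A : {set I}, [/\ A \in L, B \subset A & rk A < 2 * #|B|].
  move=> i'n BT; have [BL rB] : B \in L /\ rk B = #|B|.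
    by apply: (lattice_simplex GL (ba_T W i'n)) BT; rewrite rT// card_posT.
  by exists B; rewrite rB; split=> //; lia.
have posB t : t <= n -> phi t \in B -> posJ i d t.
  by move=> tn tB; rewrite -(mem_img inj)//; exact: (fintype.subsetP BJ).
have BE : B = img n phi (fun t => phi t \in B).
  apply: img_pre; apply: fintype.subset_trans BJ _.
  by apply/img_sub => // t tn _; rewrite mem_img.
have [B0'|B0'] := boolP (phi 0 \in B); last first.
  apply: (simpT i); first by lia.
  rewrite BE; apply/img_sub => // t tn tB; rewrite mem_img//.
  have [t0|t0] := posnP t; first by rewrite -t0 tB in B0'.
  by have := posB t tn tB; rewrite /posJ /posT; lia.
have B1 : #|B| = (#|B :\ phi 0|).+1 by rewrite (cardsD1 (phi 0)) B0'.
(* The positions in the interior of the window at [j] that [B] leaves free. *)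
pose s j := [seq h <- iota j.+1 (d - 2) | phi h \notin B].
have holes j : 0 < j -> j + d <= n.+1 -> (forall t, 0 < t <= n -> phi t \in B -> j <= t < j + d) ->
    exists A : {set I}, [/\ A \in L, B \subset A & rk A + size (s j) <= d.+1].
  move=> j0 jdn jB; have [||AL rA] := @holes_rank j (s j) j0 jdn.
  - by rewrite filter_uniq// iota_uniq.
  - by apply/allP => h; rewrite mem_filter mem_iota => /andP[_]; lia.
  eexists; split; [exact: AL| |exact: rA].
  rewrite {1}BE; apply/img_sub => // t tn tB; rewrite mem_img//.
  apply/allP => h; rewrite mem_filter mem_iota => /andP[hB hj].
  have ht : t != h by apply: contraNneq hB => <-.
  have [->//|t0] := posnP t.
  by have := jB t _ tB; rewrite t0 tn /posE => /(_ isT); lia.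
have iB t : 0 < t <= n -> phi t \in B -> i <= t < i + d.
  by move=> /andP[t0 tn] /(posB t tn); rewrite /posJ; lia.
have size_s j : 0 < j -> j + d <= n.+1 -> d - 2 <= size (s j) + #|B :\ phi 0|.
  move=> j0 jdn; rewrite -[X in X <= _](size_iota j.+1) -(count_predC [pred h | phi h \notin B]).
  rewrite size_filter leq_add2l -size_filter -(size_map phi) cardE; apply: uniq_leq_size.
    rewrite map_inj_in_uniq ?filter_uniq ?iota_uniq// => a b.
    rewrite !mem_filter !mem_iota => /andP[_ ah] /andP[_ bh]; apply: inj; lia.
  move=> z /mapP[h]; rewrite mem_filter mem_iota /= negbK => /andP[hB hj] ->.
  rewrite mem_enum !inE hB andbT; apply: contraTneq isT => /inj h0.
  have : h = 0 by apply: h0; lia.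
  by lia.
have [kd|kd] := leqP d (2 * #|B :\ phi 0|).
  exists P; rewrite (ba_L W) (ba_rk W); split=> //; last by lia.
  by rewrite (ba_P W) BE; apply/img_sub => // t tn _; rewrite mem_img.
have [k2|k2] := leqP 2 #|B :\ phi 0|.
  have [A [AL BA rA]] := holes i i0 idn iB; exists A; split=> //.
  by have := size_s i i0 idn; lia.
have [k0|k0] := posnP #|B :\ phi 0|.
  exists B; have -> : B = [set phi 0]%SET.
    apply/setP => z; rewrite !inE; apply/idP/eqP => [zB|->//].
    apply/eqP; apply: contraT => z0; have : z \in B :\ phi 0 by rewrite !inE z0.
    by move/eqP: k0; rewrite cards_eq0 => /eqP ->; rewrite inE.
  by have [vLL ->] := vL 0 isT; split=> //; rewrite cards1.
have k1 : #|B :\ phi 0| = 1 by lia.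
have [z zE] := cards1P (introT eqP k1).
have : z \in B :\ phi 0 by rewrite zE inE.
rewrite !inE => /andP[z0 zB].
have /imgP[t [tn tJ] zt] := fintype.subsetP BJ _ zB.
have t0 : 0 < t by rewrite lt0n; apply: contraNneq z0 => t0; rewrite zt t0.
have Bt u : 0 < u <= n -> phi u \in B -> u = t.
  move=> /andP[u0 un] uB; apply: inj => //; rewrite -zt.
  have : phi u \in B :\ phi 0.
    rewrite !inE uB andbT; apply/eqP => /inj u0'.
    by have : u = 0 by [apply: u0'|]; lia.
  by rewrite zE inE => /eqP.
have [td|td] := ltnP t d.
  apply: (simpT 0) => //; rewrite BE; apply/img_sub => // u un uB; rewrite mem_img//.
  have [->|u0] := posnP u; first by rewrite /posT; lia.
  by rewrite (Bt u _ uB) ?u0// /posT; lia.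
have [|||A [AL BA rA]] := holes (t + 1 - d).
- by lia.
- by lia.
- by move=> u un uB; rewrite (Bt u un uB); lia.
exists A; split=> //.
suff szs : size (s (t + 1 - d)) = d - 2 by lia.
rewrite size_filter -[RHS](size_iota (t + 1 - d).+1); apply/eqP; rewrite -all_count.
apply/allP => h; rewrite mem_iota => hj /=; apply/negP => hB.
by have := Bt h _ hB; lia.
Qed.

End Shallow.

Local Open Scope classical_set_scope.
Local Open Scope ring_scope.

(** * Convex hulls of finite families and their faces *)

Section Hom.
Variables (R : realType) (m : nat).
Implicit Types (z : 'rV[R]_m) (u : 'cV[R]_(1 + m)).

(** Points of the affine hyperplane at height 1: convex combinations become conical
    ones, affine functions become linear, and [affrank] becomes the rank. *)
Definition homog z : 'rV[R]_(1 + m) := row_mx 1%:M z.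

Definition ev u z : R := dot (homog z) u.

(** The constant function 1. *)
Definition one_ev : 'cV[R]_(1 + m) := col_mx 1%:M 0.

Lemma ev_one z : ev one_ev z = 1.
Proof. by rewrite /ev /dot mul_row_col mulmx1 mulmx0 addr0 mxE. Qed.

Lemma evD u v z : ev (u + v) z = ev u z + ev v z.
Proof. exact: dotDr. Qed.
Lemma evZ a u z : ev (a *: u) z = a * ev u z.
Proof. exact: dotZr. Qed.
Lemma evN u z : ev (- u) z = - ev u z.
Proof. exact: dotNr. Qed.
Lemma ev0 z : ev 0 z = 0.
Proof. by rewrite -(scale0r 0) evZ mul0r. Qed.

Lemma hom_sum (I : finType) (c : I -> R) (p : I -> 'rV[R]_m) :
  \sum_i c i *: homog (p i) = row_mx (\sum_i c i)%:M (\sum_i c i *: p i).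
Proof.
apply/rowP => j; rewrite summxE [RHS]mxE; case E: (fintype.split j) => [k|k].
  rewrite [RHS]mxE !ord1 eqxx mulr1n; apply: eq_bigr => i _.
  by rewrite mxE [X in _ * X]mxE E mxE !ord1 eqxx mulr1n mulr1.
by rewrite summxE; apply: eq_bigr => i _; rewrite !mxE E.
Qed.

Lemma hom_sum_eq (I : finType) (c : I -> R) (p : I -> 'rV[R]_m) z :
  homog z = \sum_i c i *: homog (p i) <->
  \sum_i c i = 1 /\ z = \sum_i c i *: p i.
Proof.
rewrite hom_sum; split=> [/eq_row_mx[/(congr1 (fun A : 'M_1 => A 0 0))]|[-> <-]//].
by rewrite !mxE /= !mulr1n => <- ->.
Qed.

(** The inequality [z *m a <= b] is the affine function [b - z *m a]. *)
Lemma faceP (P F : set 'rV[R]_m) : face P F <->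
  exists2 u, (forall z, P z -> 0 <= ev u z) & F = P `&` [set z | ev u z = 0].
Proof.
split=> [[a [b [Pab ->]]]|[u Pu ->]].
  have uE z : ev (col_mx b%:M (- a)) z = b - (z *m a) 0 0.
    by rewrite /ev /dot mul_row_col mul1mx mulmxN !mxE eqxx mulr1n.
  exists (col_mx b%:M (- a)) => [z /Pab|]; first by rewrite uE subr_ge0.
  congr (_ `&` _); apply/seteqP; split=> z /=; rewrite uE.
    by move=> ->; rewrite subrr.
  by move=> /eqP; rewrite subr_eq0 => /eqP.
have uE z : ev u z = usubmx u 0 0 - (z *m - dsubmx u) 0 0.
  rewrite -[u in LHS]vsubmxK /ev /dot mul_row_col mul1mx [LHS]mxE.
  by rewrite mulmxN [X in _ - X]mxE opprK.
exists (- dsubmx u), (usubmx u 0 0); split=> [z /Pu|]; first by rewrite uE subr_ge0.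
congr (_ `&` _); apply/seteqP; split=> z /=; rewrite uE.
  by move=> /eqP; rewrite subr_eq0 => /eqP.
by move=> ->; rewrite subrr.
Qed.

Lemma aff_indepP k (p : 'I_k -> 'rV[R]_m) :
  aff_indep p <-> row_free (\matrix_i homog (p i)).
Proof.
have sumE (c : 'I_k -> R) (v : 'rV_k) : v = \row_i c i ->
    v *m (\matrix_i homog (p i)) = row_mx (\sum_i c i)%:M (\sum_i c i *: p i).
  move=> ->; rewrite -hom_sum mulmx_sum_row; apply: eq_bigr => i _.
  by rewrite rowK mxE.
split=> [ip|fp].
  apply/row_freeP; apply/row_freeP; rewrite -kermx_eq0; apply/rowV0P => v.
  move=> /sub_kermxP; rewrite (sumE (v 0)); last by apply/rowP => i; rewrite mxE.
  rewrite -[RHS]row_mx0 => /eq_row_mx[/(congr1 (fun A : 'M_1 => A 0 0))].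
  rewrite !mxE /= mulr1n => v1 v2; apply/rowP => i; rewrite mxE.
  exact: (ip (v 0)).
move=> c c0 cp i; have /(row_free_inj fp) : (\row_i c i) *m (\matrix_i homog (p i)) =
    (0 : 'rV_k) *m (\matrix_i homog (p i)).
  by rewrite (sumE c)// c0 cp mul0mx raddf0 row_mx0.
by move=> /rowP/(_ i); rewrite !mxE.
Qed.

End Hom.

Section Hull.
Variables (R : realType) (m N : nat) (x : 'I_N -> 'rV[R]_m).
Implicit Types (A B C : {set 'I_N}) (u : 'cV[R]_(1 + m)).

(** Coefficients are indexed by the whole family and vanish off [A], so that
    different subsets of the family share their coordinates. *)
Definition hull A : set 'rV[R]_m :=
  [set z | exists c : 'I_N -> R, [/\ forall i, 0 <= c i,
     forall i, i \notin A -> c i = 0 & homog z = \sum_i c i *: homog (x i)]].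

Lemma hull_conv A : hull A = conv (x @` [set i | i \in A]).
Proof.
apply/seteqP; split=> z.
  move=> [c [c0 cA /hom_sum_eq[c1 ->]]].
  have big_A (V : nmodType) (F : 'I_N -> V) : (forall i, i \notin A -> F i = 0) ->
      \sum_i F i = \sum_(j < #|A|) F (enum_val j).
    move=> F0; rewrite -(big_enum_val F) [RHS]big_mkcond /=.
    by apply: eq_bigr => i _; case: ifPn => // /F0.
  exists #|A|, (fun j => x (enum_val j)), (fun j => c (enum_val j)); split=> //.
  - by move=> i; exists (enum_val i) => //=; exact: enum_valP.
  - by rewrite -c1 [RHS]big_A.
  - by rewrite big_A// => i /cA ->; rewrite scale0r.
move=> [k [p [c [/= pA c0 c1 ->]]]].
have /choice[f fE] : forall i, exists j, j \in A /\ x j = p i.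
  by move=> i; have [j ? ?] := pA i; exists j.
exists (fun j => \sum_(i | f i == j) c i); split.
- by move=> j; rewrite sumr_ge0.
- by move=> j jA; rewrite big1// => i /eqP fi; case: (fE i); rewrite fi (negbTE jA).
apply/hom_sum_eq; split.
  by rewrite -c1 [RHS](partition_big f xpredT).
rewrite (partition_big f xpredT)//=; apply: eq_bigr => j _.
by rewrite scaler_suml; apply: eq_bigr => i /eqP <-; case: (fE i) => _ ->.
Qed.

Lemma mem_hull A i : i \in A -> hull A (x i).
Proof.
move=> iA; exists (fun j => (j == i)%:R); split.
- by move=> j; rewrite ler0n.
- by move=> j; case: eqP => // ->; rewrite iA.
- rewrite (bigD1 i)//= eqxx scale1r big1 ?addr0// => j /negbTE ->.
  by rewrite scale0r.
Qed.

Lemma hullS A B : A \subset B -> hull A `<=` hull B.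
Proof.
move=> AB z [c [c0 cA zE]]; exists c; split=> // i iB; apply: cA.
by apply: contra iB; exact: (fintype.subsetP AB).
Qed.

Lemma ev_sum u z (c : 'I_N -> R) : homog z = \sum_i c i *: homog (x i) ->
  ev u z = \sum_i c i * ev u (x i).
Proof.
by move=> zE; rewrite /ev zE dot_suml; apply: eq_bigr => i _; rewrite dotZl.
Qed.

Lemma ev_hull_ge0 A u z : (forall i, i \in A -> 0 <= ev u (x i)) -> hull A z ->
  0 <= ev u z.
Proof.
move=> Au [c [c0 cA /ev_sum ->]]; apply: sumr_ge0 => i _.
by have [/Au|/cA ->] := boolP (i \in A); [exact: mulr_ge0|rewrite mul0r].
Qed.

Definition zeros A u : {set 'I_N} := [set i in A | ev u (x i) == 0].

Lemma zeros_sub A u : zeros A u \subset A.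
Proof. by apply/fintype.subsetP => i; rewrite inE => /andP[]. Qed.

(** A nonnegative function vanishes at a convex combination only if it vanishes
    at every point of positive weight. *)
Lemma hull_zeros A u : (forall i, i \in A -> 0 <= ev u (x i)) ->
  hull A `&` [set z | ev u z = 0] = hull (zeros A u).
Proof.
move=> Au; apply/seteqP; split=> z.
  move=> [[c [c0 cA zE]] /= uz]; exists c; split=> // i.
  rewrite inE negb_and => /orP[/cA//|ui]; apply: contraNeq ui => ci.
  have [iA|/cA ci0] := boolP (i \in A); last by rewrite ci0 eqxx in ci.
  have ge0 j : 0 <= c j * ev u (x j).
    by have [/Au|/cA ->] := boolP (j \in A); [exact: mulr_ge0|rewrite mul0r].
  move: uz; rewrite (ev_sum _ zE) => /eqP; rewrite psumr_eq0// => /allP/(_ i).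
  by rewrite mem_index_enum mulf_eq0 (negbTE ci) => /(_ isT).
move=> zz; split; first exact: hullS (zeros_sub A u) _ zz.
case: zz => c [c0 cA /ev_sum /= ->]; rewrite big1// => i _.
have [|/cA ->] := boolP (i \in zeros A u); last by rewrite mul0r.
by rewrite inE => /andP[_ /eqP ->]; rewrite mulr0.
Qed.

Definition isface A B :=
  exists2 u, forall i, i \in A -> 0 <= ev u (x i) & B = zeros A u.

Lemma face_hullP A F : face (hull A) F <-> exists2 B, isface A B & F = hull B.
Proof.
rewrite faceP; split=> [[u Au ->]|[B [u Au ->] ->]].
  have Au' i : i \in A -> 0 <= ev u (x i) by move=> /mem_hull/Au.
  by exists (zeros A u); [exists u|rewrite hull_zeros].
exists u => [z|]; first exact: ev_hull_ge0.
by rewrite hull_zeros.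
Qed.

Lemma isface_sub A B : isface A B -> B \subset A.
Proof. by move=> [u _ ->]; exact: zeros_sub. Qed.

Lemma isface_refl A : isface A A.
Proof.
exists 0 => [i _|]; first by rewrite ev0.
by apply/setP => i; rewrite inE ev0 eqxx andbT.
Qed.

Lemma isface0 A : isface A finset.set0.
Proof.
exists (one_ev R m) => [i _|]; first by rewrite ev_one.
by apply/setP => i; rewrite !inE ev_one oner_eq0 andbF.
Qed.

Lemma isfaceI A B C : isface A B -> isface A C -> isface A (B :&: C).
Proof.
move=> [u Au ->] [v Av ->]; exists (u + v) => [i iA|].
  by rewrite evD addr_ge0 ?Au ?Av.
apply/setP => i; rewrite !inE evD; case iA: (i \in A) => //=.
by rewrite paddr_eq0 ?Au ?Av.
Qed.

Lemma isfaceW A B C : isface A C -> B \subset A -> C \subset B -> isface B C.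
Proof.
move=> [u Au CE] BA CB; exists u => [i /(fintype.subsetP BA)|]; first exact: Au.
apply/setP => i; have [iB|iB] := boolP (i \in B).
  by rewrite CE !inE iB (fintype.subsetP BA).
rewrite inE (negbTE iB); apply: contraNF iB; exact: (fintype.subsetP CB).
Qed.

(** The function exposing [C] in [B] may be negative on [A] outside [B]; adding a
    large multiple of the function exposing [B] in [A] makes it positive there. *)
Lemma isface_trans A B C : isface A B -> isface B C -> isface A C.
Proof.
move=> [u Au BE] [v Bv CE].
(* Any [la] exceeding every ratio of the two functions would do. *)
pose la := 1 + \sum_(i in A :\: B) `|ev v (x i)| / ev u (x i).
have u_gt0 i : i \in A :\: B -> 0 < ev u (x i).
  by rewrite BE !inE => /andP[]; case iA: (i \in A) => //= ui _; rewrite lt0r ui Au.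
have la_gt0 : 0 < la.
  by rewrite ltr_pwDl// sumr_ge0// => i /u_gt0/ltW ?; rewrite divr_ge0.
have w_gt0 i : i \in A :\: B -> 0 < ev (v + la *: u) (x i).
  move=> iAB; rewrite evD evZ -ltrBlDl sub0r.
  have -> : - ev v (x i) = (- ev v (x i) / ev u (x i)) * ev u (x i).
    by rewrite divfK// gt_eqF// u_gt0.
  rewrite ltr_pM2r ?u_gt0// /la (bigD1 i)//= addrA ltr_wpDr//.
    by rewrite sumr_ge0// => j /andP[/u_gt0/ltW ? _]; rewrite divr_ge0.
  rewrite ltr_pwDl// ler_pM2r ?invr_gt0 ?u_gt0//.
  by rewrite -normrN ler_norm.
have wB i : i \in B -> ev (v + la *: u) (x i) = ev v (x i).
  by rewrite evD evZ BE inE => /andP[_ /eqP ->]; rewrite mulr0 addr0.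
exists (v + la *: u) => [i iA|].
  have [iB|iB] := boolP (i \in B); first by rewrite wB// Bv.
  by rewrite ltW// w_gt0// inE iB.
apply/setP => i; rewrite CE !inE; have [iB|iB] := boolP (i \in B).
  by rewrite wB// (fintype.subsetP (isface_sub (ex_intro2 _ _ u Au BE))).
apply/esym; rewrite /=; case iA: (i \in A) => //=.
by rewrite gt_eqF// w_gt0// inE iB.
Qed.

Lemma isface_mem A B i : isface A B -> i \in A -> hull B (x i) -> i \in B.
Proof.
move=> [u Au ->] iA; rewrite -hull_zeros// => -[_ /= ui].
by rewrite inE iA ui eqxx.
Qed.

Lemma isface_hull_inj A B C : isface A B -> isface A C -> hull B = hull C -> B = C.
Proof.
move=> AB AC BC; apply/setP => i; apply/idP/idP => iX.
  apply: isface_mem AC _ _; first exact: (fintype.subsetP (isface_sub AB)).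
  by rewrite -BC; exact: mem_hull.
apply: isface_mem AB _ _; first exact: (fintype.subsetP (isface_sub AC)).
by rewrite BC; exact: mem_hull.
Qed.

Definition hmx A : 'M[R]_(N, 1 + m) := \matrix_i if i \in A then homog (x i) else 0.
Definition rk A : nat := \rank (hmx A).

Lemma hom_hmx A i : i \in A -> (homog (x i) <= hmx A)%MS.
Proof. by move=> iA; rewrite -[homog _](_ : row i (hmx A) = _) ?row_sub// rowK iA. Qed.

Lemma hmx_subP k A (B : 'M_(k, 1 + m)) :
  (forall i, i \in A -> (homog (x i) <= B)%MS) -> (hmx A <= B)%MS.
Proof.
by move=> AB; apply/row_subP => i; rewrite rowK; case: ifP => [/AB//|_]; exact: sub0mx.
Qed.

Lemma hmxS A B : A \subset B -> (hmx A <= hmx B)%MS.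
Proof.
by move=> AB; apply: hmx_subP => i iA; apply: hom_hmx; exact: (fintype.subsetP AB).
Qed.

Lemma hull_hmx A z : hull A z -> (homog z <= hmx A)%MS.
Proof.
move=> [c [_ cA ->]]; apply: summx_sub => i _; have [iA|/cA ->] := boolP (i \in A).
  by apply: scalemx_sub; exact: hom_hmx.
by rewrite scale0r sub0mx.
Qed.

Lemma ev_hmx A u z : (homog z <= hmx A)%MS -> (forall i, i \in A -> ev u (x i) = 0) ->
  ev u z = 0.
Proof.
move=> /submxP[D zE] Au; rewrite /ev zE mulmx_sum_row dot_suml big1// => i _.
rewrite dotZl rowK; case: ifP => [/Au ui|_]; last by rewrite dot0l mulr0.
by rewrite -/(ev _ _) ui mulr0.
Qed.

Lemma rkS A B : A \subset B -> (rk A <= rk B)%N.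
Proof. by move=> /hmxS/mxrankS. Qed.

(** A maximal independent set of rows of [hmx A] avoids its zero rows. *)
Lemma rk_indices A : exists2 f : 'I_(rk A) -> 'I_N,
  injective f /\ (forall i, f i \in A) & aff_indep (fun i => x (f i)).
Proof.
pose f := maxrankfun (hmx A).
have ff : row_free (rowsub f (hmx A)) by exact: maxrowsub_free.
have fA i : f i \in A.
  apply: contraT => /negbTE fi; have : delta_mx 0 i = 0 :> 'rV[R]_(rk A).
    apply: (row_free_inj ff); rewrite mul0mx -rowE row_rowsub rowK.
    by move: fi => ->.
  by move=> /rowP/(_ i); rewrite !mxE !eqxx => /eqP; rewrite oner_eq0.
exists f; first by split=> //; exact: maxrankfun_inj.
apply/aff_indepP; suff -> : \matrix_i homog (x (f i)) = rowsub f (hmx A) by [].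
by apply/row_matrixP => i; rewrite row_rowsub !rowK fA.
Qed.

Lemma rk_card A : (rk A <= #|A|)%N.
Proof.
have [f [fi fA] _] := rk_indices A.
rewrite -[X in (X <= _)%N]card_ord -(card_codom fi); apply: subset_leq_card.
by apply/fintype.subsetP => i /codomP[j ->].
Qed.

Lemma affrank_hull A : affrank (hull A) = rk A.
Proof.
apply/eqP; rewrite eqn_leq; apply/andP; split; last first.
  have [f [_ fA] ip] := rk_indices A.
  by apply: affrank_ge ip _ => i; exact: mem_hull.
have [p /aff_indepP fp pA] := affrank_witness (hull A).
rewrite -(eqP fp); apply: mxrankS; apply/row_subP => i; rewrite rowK.
exact: hull_hmx.
Qed.

Lemma rkU A B : (rk (A :|: B) <= rk A + rk B)%N.
Proof.
apply: leq_trans (mxrank_adds_leqif (hmx A) (hmx B)); apply: mxrankS.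
apply: hmx_subP => i; rewrite inE => /orP[] /hom_hmx iX.
  by apply: submx_trans iX _; exact: addsmxSl.
by apply: submx_trans iX _; exact: addsmxSr.
Qed.

Lemma rk_lt A B i : B \subset A -> i \in A -> ~~ (homog (x i) <= hmx B)%MS ->
  (rk B < rk A)%N.
Proof.
move=> BA iA iB; apply: rank_ltmx; rewrite ltmxE hmxS//=.
by apply: contra iB; apply: submx_trans; exact: hom_hmx.
Qed.

Lemma isface_notin A B i : isface A B -> i \in A -> i \notin B ->
  ~~ (homog (x i) <= hmx B)%MS.
Proof.
move=> [u Au BE] iA; apply: contra => /ev_hmx ui.
by rewrite BE inE iA ui ?eqxx// => j; rewrite BE inE => /andP[_ /eqP].
Qed.

Lemma isface_rk A B : isface A B -> B != A -> (rk B < rk A)%N.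
Proof.
move=> AB; rewrite finset.eqEsubset (isface_sub AB) => /fintype.subsetPn[i iA iB].
by apply: (rk_lt (isface_sub AB) iA); exact: (isface_notin AB iA iB).
Qed.

Lemma zrows_hmx A u : zrows (hmx A) u = hmx (zeros A u).
Proof.
apply/row_matrixP => i; rewrite !rowK inE.
by case: (i \in A) => //=; case: ifP.
Qed.

Lemma row_hmx_ge0 A u : (forall i, i \in A -> 0 <= ev u (x i)) ->
  forall i, 0 <= dot (row i (hmx A)) u.
Proof. by move=> Au i; rewrite rowK; case: ifP => [/Au//|_]; rewrite dot0l. Qed.

Lemma row_hmx_ge0_inv A u : (forall i, 0 <= dot (row i (hmx A)) u) ->
  forall i, i \in A -> 0 <= ev u (x i).
Proof. by move=> Au i iA; have := Au i; rewrite rowK iA. Qed.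

(** Extend the function exposing [B] by [extremal_functional], with the opposite of the
    point [i] as the vector to keep negative. *)
Lemma facet_avoiding A B i : isface A B -> i \in A -> i \notin B ->
  exists C, [/\ isface A C, B \subset C, i \notin C & (rk C).+1 = rk A].
Proof.
move=> [u Au BE] iA iB.
have ui : dot (- homog (x i)) u < 0.
  by rewrite dotNl oppr_lt0 -/(ev _ _) lt0r Au// andbT; move: iB; rewrite BE inE iA.
have iW : (- homog (x i) <= hmx A)%MS by rewrite eqmx_opp; exact: hom_hmx.
have [v [Av vi uv rkv]] := extremal_functional iW (row_hmx_ge0 Au) ui.
move: Av rkv => /row_hmx_ge0_inv Av; rewrite zrows_hmx => rkv.
exists (zeros A v); split=> //; first by exists v.
  apply/fintype.subsetP => j; rewrite BE !inE => /andP[jA /eqP uj].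
  by rewrite jA; have := uv j; rewrite rowK jA => /(_ uj) /eqP.
by rewrite inE iA /=; move: vi; rewrite dotNl oppr_lt0 -/(ev _ _) => /gt_eqF ->.
Qed.

Lemma hull_separation A q : ~ hull A q ->
  exists2 u, (forall i, i \in A -> 0 <= ev u (x i)) & ev u q < 0.
Proof.
move=> nq; apply: contrapT => nu; apply: nq.
have [u Au|c c0 qE] := @farkas _ _ _ (fun i => row i (hmx A)) (homog q).
  by rewrite leNgt; apply/negP => uq; apply: nu; exists u => //; exact: row_hmx_ge0_inv.
exists (fun i => if i \in A then c i else 0); split=> [i|i /negbTE ->//|].
  by case: ifP.
rewrite qE; apply: eq_bigr => i _; rewrite rowK.
by case: ifP => //; rewrite scaler0 scale0r.
Qed.

(** Polytopes are cut out of their affine hull by their facets. *)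
Lemma facet_separating A q : (homog q <= hmx A)%MS -> ~ hull A q ->
  exists u, [/\ forall i, i \in A -> 0 <= ev u (x i), ev u q < 0
    & (rk (zeros A u)).+1 = rk A].
Proof.
move=> qA /hull_separation[u Au uq].
have [v [Av vq _ rkv]] := extremal_functional qA (row_hmx_ge0 Au) uq.
exists v; split=> //; first exact: row_hmx_ge0_inv.
by rewrite /rk -zrows_hmx.
Qed.

Lemma simplex_rk_sub A B : rk A = #|A| -> B \subset A -> rk B = #|B|.
Proof.
move=> rA BA; apply/eqP; rewrite eqn_leq rk_card/=.
have := rkU B (A :\: B); rewrite finset.setDE finset.setUIr finset.setUCr finset.setIT.
move/finset.setUidPr : (BA) => ->; rewrite rA -(cardsID B A) (finset.setIidPr BA) -finset.setDE.
by move=> h; rewrite -(leq_add2r #|A :\: B|) (leq_trans h)// leq_add2l rk_card.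
Qed.

(** Each point lies outside the span of the others, which gives the faces missing
    one point; the other faces are intersections of these. *)
Lemma simplex_isface A B : rk A = #|A| -> B \subset A -> isface A B.
Proof.
move=> rA; have D1 i : i \in A -> isface A (A :\ i).
  move=> iA; have /separate_row[u Au ui] : ~~ (homog (x i) <= hmx (A :\ i))%MS.
    apply/negP => iAi; have /mxrankS : (hmx A <= hmx (A :\ i))%MS.
      apply: hmx_subP => j jA; have [->//|ji] := eqVneq j i.
      by apply: hom_hmx; rewrite !inE ji.
    rewrite -/(rk _) -/(rk _) rA => /leq_trans /(_ (rk_card _)).
    by rewrite (cardsD1 i A) iA ltnn.
  have uz j : j \in A -> j != i -> ev u (x j) = 0.
    move=> jA ji; have := congr1 (fun v : 'cV_N => v j 0) Au.
    by rewrite /= -dot_row rowK !inE ji jA mxE.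
  exists (- u) => [j jA|]; rewrite ?evN.
    have [->|ji] := eqVneq j i; first by rewrite oppr_ge0 ltW.
    by rewrite uz// oppr0.
  apply/setP => j; rewrite !inE evN oppr_eq0 andbC; case jA: (j \in A) => //=.
  by have [->|ji] := eqVneq j i; [rewrite /ev lt_eqF|rewrite uz// eqxx].
move: {2}#|A :\: B| (erefl #|A :\: B|) => k; elim: k B => [|k IH] B kB BA.
  suff -> : B = A by exact: isface_refl.
  by apply/eqP; rewrite finset.eqEsubset BA -finset.setD_eq0 -cards_eq0 kB eqxx.
have /card_gt0P[i iAB] : (0 < #|A :\: B|)%N by rewrite kB.
move: (iAB); rewrite inE => /andP[iB iA].
have -> : B = (i |: B) :&: (A :\ i).
  apply/setP => j; rewrite !inE; have [->|ji] /= := eqVneq j i; first by rewrite (negbTE iB).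
  by apply/idP/andP => [jB|[]//]; rewrite jB (fintype.subsetP BA).
apply: isfaceI (D1 _ iA); apply: IH; last by rewrite finset.subUset finset.sub1set iA.
by move: kB; rewrite (cardsD1 i) iAB finset.setDDl finset.setUC => -[].
Qed.

End Hull.

Section Vertices.
Variables (R : realType) (m : nat).

Lemma hull1 N (x : 'I_N -> 'rV[R]_m) i : hull x [set i]%SET = [set x i].
Proof.
apply/seteqP; split=> z; last by move=> ->; apply: mem_hull; rewrite inE.
move=> [c [_ ci /hom_sum_eq[c1 ->]]] /=.
have {}c1 : c i = 1.
  by rewrite -c1 (bigD1 i)//= big1 ?addr0// => j ji; rewrite ci// inE.
rewrite (bigD1 i)//= c1 scale1r big1 ?addr0// => j ji.
by rewrite ci ?scale0r// inE.
Qed.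

Lemma hull_hull N K (x : 'I_N -> 'rV[R]_m) (y : 'I_K -> 'rV[R]_m)
    (A : {set 'I_N}) (B : {set 'I_K}) :
  (forall i, i \in B -> hull x A (y i)) -> hull y B `<=` hull x A.
Proof.
move=> yA z [c [c0 cB zE]].
have /choice[e eP] : forall i, exists e : 'I_N -> R, i \in B ->
    [/\ forall j, 0 <= e j, forall j, j \notin A -> e j = 0
      & homog (y i) = \sum_j e j *: homog (x j)].
  move=> i; have [/yA[e eP]|_] := boolP (i \in B); first by exists e.
  by exists (fun=> 0).
exists (fun j => \sum_(i in B) c i * e i j); split.
- by move=> j; apply: sumr_ge0 => i /eP[e0 _ _]; rewrite mulr_ge0.
- by move=> j jA; apply: big1 => i /eP[_ eA _]; rewrite eA// mulr0.
rewrite zE (bigID [in B])/= [X in _ + X]big1 ?addr0 => [|i /cB ->]; last first.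
  by rewrite scale0r.
under [RHS]eq_bigr do rewrite scaler_suml.
rewrite exchange_big /=; apply: eq_bigr => i /eP[_ _ ->].
by rewrite scaler_sumr; apply: eq_bigr => j _; rewrite scalerA.
Qed.

(** In a generating family of minimal size no point is in the hull of the others,
    and a function separating a point from the others, translated to vanish
    there, exposes it. *)
Lemma polytope_minimal (P : set 'rV[R]_m) : polytope P ->
  exists N (x : 'I_N -> 'rV[R]_m),
    P = hull x [set: 'I_N]%SET /\ forall i, isface x [set: 'I_N]%SET [set i]%SET.
Proof.
move=> [V /finite_seqP[s ->] PE].
pose gen N := exists x : 'I_N -> 'rV[R]_m, P = hull x [set: 'I_N]%SET.
have exN : exists N, `[< gen N >].
  exists (size s); apply/asboolP; exists (fun i => nth 0 s i).
  rewrite PE hull_conv; congr conv; apply/seteqP; split=> z /=.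
    move=> zs; have si : (index z s < size s)%N by rewrite index_mem.
    by exists (Ordinal si); rewrite //= ?inE// nth_index.
  by move=> [i _ <-]; exact: mem_nth.
case: (ex_minnP exN) => N /asboolP[x Px] minN; exists N, x; split=> // i.
have /hull_separation[u ui uxi] : ~ hull x [set~ i]%SET (x i).
  move=> xi; case: N x Px minN i xi => [x _ _ []//|N] x Px minN i xi.
  suff /asboolP/minN : gen N by rewrite ltnn.
  have yi k : k != i -> hull (fun j => x (lift i j)) [set: 'I_N]%SET (x k).
    move=> ki; have [j ->] : exists j, k = lift i j.
      by case: (unliftP i k) ki => [j|] ->; [exists j|rewrite eqxx].
    by apply: (@mem_hull _ _ _ (fun j => x (lift i j))).
  exists (fun j => x (lift i j)); rewrite Px; apply/seteqP; split; last first.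
    by apply: hull_hull => j _; exact: mem_hull.
  apply: hull_hull => k _; have [->|/yi//] := eqVneq k i.
  by apply: hull_hull xi => j; rewrite !inE; exact: yi.
(* Translate the separating function to vanish at [x i]. *)
pose v := u - ev u (x i) *: one_ev R m.
have vE k : ev v (x k) = ev u (x k) - ev u (x i).
  by rewrite /v evD evN evZ ev_one mulr1.
exists v => [k _|].
  rewrite vE; have [->|ki] := eqVneq k i; first by rewrite subrr.
  by rewrite subr_ge0 (le_trans (ltW uxi))// ui// !inE.
apply/setP => k; rewrite !inE vE subr_eq0; have [->|ki] := eqVneq k i.
  by rewrite eqxx.
by rewrite gt_eqF// (lt_le_trans uxi)// ui// !inE.
Qed.

Lemma vertices_hull N (y : 'I_N -> 'rV[R]_m) (P : set 'rV[R]_m) :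
  polytope P -> vertices P = range y -> P = hull y [set: 'I_N]%SET.
Proof.
move=> /polytope_minimal[K [x [-> xv]]] Py; apply/seteqP; split.
  apply: hull_hull => k _.
  have : vertices (hull x [set: 'I_K]%SET) (x k).
    by apply/face_hullP; exists [set k]%SET; rewrite ?hull1.
  by rewrite Py => -[i _ <-]; exact: mem_hull.
apply: hull_hull => i _.
have : vertices (hull x [set: 'I_K]%SET) (y i) by rewrite Py; exists i.
by move=> [a [b [_ iE]]]; have : [set y i] (y i) by []; rewrite iE => -[].
Qed.

Lemma vertex_isface N (x : 'I_N -> 'rV[R]_m) i : injective x ->
  vertices (hull x [set: 'I_N]%SET) (x i) <-> isface x [set: 'I_N]%SET [set i]%SET.
Proof.
move=> xi; split; last by move=> ?; apply/face_hullP; exists [set i]%SET; rewrite ?hull1.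
move=> /face_hullP[B fB BE]; suff <- : B = [set i]%SET by [].
apply/setP => j; rewrite inE; apply/idP/eqP => [jB|->].
  by apply: xi; have := mem_hull x jB; rewrite -BE.
by apply: isface_mem fB _ _; rewrite ?inE// -BE.
Qed.

Lemma isfaceT N (x : 'I_N -> 'rV[R]_m) A B : isface x [set: 'I_N]%SET A ->
  isface x A B <-> isface x [set: 'I_N]%SET B /\ B \subset A.
Proof.
move=> fA; split=> [fB|[fB BA]]; last by apply: isfaceW fB _ BA; exact: finset.subsetT.
by split; [exact: isface_trans fA fB|exact: isface_sub fB].
Qed.

Lemma h_from_g_hull N (x : 'I_N -> 'rV[R]_m) A g :
  h_from_g g (hull x A) =
  \sum_(B : {set 'I_N} | `[< isface x A B >] && (B != A))
     g (hull x B) * ('X - 1) ^+ (rk x A - 1 - rk x B).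
Proof.
rewrite /h_from_g.
have -> : [set F | face (hull x A) F /\ F <> hull x A] =
    hull x @` [set` [pred B : {set 'I_N} | `[< isface x A B >] && (B != A)]].
  apply/seteqP; split=> F /=.
    move=> [/face_hullP[B fB ->] BA]; exists B => //=.
    rewrite unfold_in /= asboolT//=; apply: contra_notN BA => /eqP -> //.
  move=> [B /= /andP[/asboolP fB /eqP BA] <-]; split.
    by apply/face_hullP; exists B.
  by move=> /(isface_hull_inj fB (isface_refl x A)).
rewrite fsbig_image; last first.
  move=> B C; rewrite !inE /= => /andP[/asboolP fB _] /andP[/asboolP fC _].
  exact: isface_hull_inj fB fC.
rewrite -(@bigfs _ _ _ _ (index_enum _)) ?index_enum_uniq//; last first.
  by move=> B _; rewrite mem_index_enum.
apply: eq_bigr => B /andP[/asboolP fB BA]; congr (_ * _ ^+ _).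
rewrite /Defs.dim !affrank_hull; have := isface_rk fB BA.
by lia.
Qed.

End Vertices.

Section Lattice.
Variables (R : realType) (m N : nat) (x : 'I_N -> 'rV[R]_m).
Implicit Types (A B C : {set 'I_N}) (u : 'cV[R]_(1 + m)).
Local Notation T := [set: 'I_N]%SET.

Definition facelat : {set {set 'I_N}} := [set A : {set 'I_N} | `[< isface x T A >]]%SET.

Lemma facelatP A : reflect (isface x T A) (A \in facelat).
Proof. by rewrite inE; exact: asboolP. Qed.

Lemma facelat_isface A B : A \in facelat ->
  `[< isface x A B >] = (B \in facelat) && (B \subset A).
Proof.
move=> /facelatP fA; apply/asboolP/andP => [/(isfaceT _ fA)[/facelatP]//|].
by move=> [/facelatP fB BA]; apply/(isfaceT _ fA).
Qed.

Lemma facelat_graded : graded_lattice facelat (rk x).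
Proof.
split.
- exact/facelatP/isface_refl.
- exact/facelatP/isface0.
- by move=> A B /facelatP ? /facelatP ?; exact/facelatP/isfaceI.
- move=> A B AL BL; rewrite finset.properEneq => /andP[AB AsB].
  by apply: isface_rk => //; apply/asboolP; rewrite facelat_isface// AL.
- move=> A P i AL PL AP iP iA; have /asboolP fA : `[< isface x P A >].
    by rewrite facelat_isface// AL.
  have [C [fC AC iC rC]] := facet_avoiding fA iP iA; exists C.
  by move/asboolP: fC; rewrite facelat_isface// => /andP[-> ->].
- move=> A B AL rA BA; split; last exact: simplex_rk_sub rA BA.
  have /asboolP := simplex_isface rA BA; by rewrite facelat_isface// => /andP[].
Qed.

Lemma hull0 : hull x finset.set0 = set0.
Proof.
apply/seteqP; split=> z // -[c [_ c0 /hom_sum_eq[c1 _]]].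
move: c1; rewrite big1 => [/esym/eqP|i _]; first by rewrite oner_eq0.
by rewrite c0// inE.
Qed.

Lemma facelat_h g A : A \in facelat -> h_from_g g (hull x A) =
  \sum_(B : {set 'I_N} | (B \in facelat) && (B \proper A))
     g (hull x B) * ('X - 1) ^+ (rk x A - 1 - rk x B).
Proof.
move=> AL; rewrite h_from_g_hull; apply: eq_bigl => B.
by rewrite facelat_isface// finset.properEneq -andbA [(B \subset A) && _]andbC.
Qed.

Lemma facelat_toric : toric_rec facelat (rk x) (fun A => toric_g (hull x A)).
Proof.
split=> [|A AL A0]; first by rewrite hull0 toric_g0.
rewrite toric_gE ?affrank_hull; first by rewrite /toric_h facelat_h.
have /finset.set0Pn[i iA] := A0 => hA.
by have := mem_hull x iA; rewrite hA.
Qed.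

(** The exposing function of the vertex is positive on every other point of the
    family. *)
Lemma hull_vertex A i : isface x T [set i]%SET -> hull x A (x i) -> i \in A.
Proof.
move=> [u Tu iE] xi; apply: contraT => iA.
have ui : ev u (x i) = 0.
  have : i \in [set i]%SET by rewrite inE.
  by rewrite iE inE => /andP[_ /eqP].
have : (hull x A `&` [set z | ev u z = 0]) (x i) by [].
rewrite hull_zeros => [|j _]; last by rewrite Tu// inE.
suff -> : zeros x A u = finset.set0 by rewrite hull0.
apply/setP => j; rewrite [RHS]inE; apply/negP; rewrite inE => /andP[jA uj].
have : j \in zeros x T u by rewrite inE uj inE.
by rewrite -iE inE => /eqP ji; rewrite -ji jA in iA.
Qed.

Lemma face_facelat A : (forall i, isface x T [set i]%SET) ->
  face (hull x T) (hull x A) <-> A \in facelat.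
Proof.
move=> xv; split=> [/face_hullP[B fB AB]|/facelatP fA]; last first.
  by apply/face_hullP; exists A.
suff -> : A = B by apply/facelatP.
apply/setP => i; apply/idP/idP => iX; apply: hull_vertex => //.
  by rewrite -AB; exact: mem_hull.
by rewrite AB; exact: mem_hull.
Qed.

Lemma simplex_hull A : rk x A = #|A| -> simplex (hull x A).
Proof.
move=> rA; have [f [fi fA] ip] := rk_indices x A.
exists (rk x A), (fun i => x (f i)) => //.
rewrite hull_conv; congr conv; apply/seteqP; split=> z.
  move=> [i /= iA <-]; suff /codomP[j ->] : i \in codom f by exists j.
  have cA : #|codom f| = #|A| by rewrite card_codom// card_ord.
  have fsA : codom f \subset A by apply/fintype.subsetP => _ /codomP[j ->].
  by rewrite (subset_cardP cA fsA).
by move=> [j _ <-]; exists (f j) => //=; exact: fA.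
Qed.

Lemma simplex_inter A B C : rk x A = #|A| -> B \subset A -> C \subset A ->
  hull x B `&` hull x C = hull x (B :&: C).
Proof.
move=> rA BA CA; have [u Au BE] := simplex_isface rA BA; have [v Av CE] := simplex_isface rA CA.
have BCE : B :&: C = zeros x A (u + v).
  apply/setP => i; rewrite BE CE !inE evD; case iA: (i \in A) => //=.
  by rewrite paddr_eq0 ?Au ?Av.
have uv_ge0 i : i \in A -> 0 <= ev (u + v) (x i).
  by move=> iA; rewrite evD addr_ge0 ?Au ?Av.
apply/seteqP; split=> z.
  move=> [zB zC]; rewrite BCE -hull_zeros//; split; first exact: hullS BA _ zB.
  move: zB zC; rewrite BE CE -!hull_zeros// => -[_ /= zu] [_ /= zv].
  by rewrite evD zu zv addr0.
move=> zBC; split; apply: hullS zBC.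
  exact: finset.subsetIl.
exact: finset.subsetIr.
Qed.

Lemma hull_segment A p q t : 0 <= t <= 1 -> hull x A p -> hull x A q ->
  hull x A ((1 - t) *: p + t *: q).
Proof.
move=> /andP[t0 t1] [c [c0 cA pE]] [e [e0 eA qE]].
exists (fun i => (1 - t) * c i + t * e i); split.
- by move=> i; rewrite addr_ge0// mulr_ge0// subr_ge0.
- by move=> i iA; rewrite cA// eA// !mulr0 addr0.
move: pE qE => /hom_sum_eq[c1 ->] /hom_sum_eq[e1 ->]; apply/hom_sum_eq; split.
  by rewrite big_split /= -!mulr_sumr c1 e1 !mulr1 subrK.
rewrite !scaler_sumr -big_split /=; apply: eq_bigr => i _; by rewrite [in RHS]scalerDl !scalerA.
Qed.

Lemma homog_segment p q t :
  homog ((1 - t) *: p + t *: q) = (1 - t) *: homog p + t *: homog q :> 'rV[R]_(1 + m).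
Proof.
have := hom_sum (fun b : bool => if b then 1 - t else t) (fun b => if b then p else q).
by rewrite !big_bool /= subrK => ->.
Qed.

Lemma ev_segment u p q t : ev u ((1 - t) *: p + t *: q) = (1 - t) * ev u p + t * ev u q.
Proof. by rewrite /ev homog_segment dotDl !dotZl. Qed.

End Lattice.

(** * Pulling triangulations *)

Section Pulling.
Variables (R : realType) (m N : nat) (x : 'I_N -> 'rV[R]_m) (a : 'I_N).
Implicit Types (A B C : {set 'I_N}) (u : 'cV[R]_(1 + m)).
Local Notation T := [set: 'I_N]%SET.
Hypothesis x_vertex : forall i, isface x T [set i]%SET.

Definition opposite C := [/\ isface x T C, (rk x C).+1 = rk x T & a \notin C].

Definition height C u :=
  [/\ forall i, 0 <= ev u (x i), C = zeros x T u & ev u (x a) = 1].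

Lemma heightP C : opposite C -> exists u, height C u.
Proof.
move=> [[u Tu CE] _ aC].
have ua : 0 < ev u (x a).
  by rewrite lt0r Tu ?inE// andbT; move: aC; rewrite CE !inE.
exists ((ev u (x a))^-1 *: u); split.
- by move=> i; rewrite evZ mulr_ge0// ?invr_ge0 ?Tu ?inE// ltW.
- by apply/setP => i; rewrite CE !inE evZ mulf_eq0 invr_eq0 (gt_eqF ua).
- by rewrite evZ mulVf// gt_eqF.
Qed.

Lemma rk_pull C : opposite C -> rk x (a |: C) = rk x T.
Proof.
move=> [fC rC aC]; apply/eqP; rewrite eqn_leq rkS ?finset.subsetT//= -rC.
apply: (@rk_lt _ _ _ _ _ _ a); rewrite ?finset.setU11 ?finset.subsetUr//.
exact: (isface_notin fC (finset.in_setT a) aC).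
Qed.

Lemma hmx_pull C : opposite C -> (hmx x T <= hmx x (a |: C))%MS.
Proof.
move=> oC; rewrite -(geq_leqif (mxrank_leqif_sup (hmxS x (finset.subsetT _)))).
by rewrite -/(rk x _) -/(rk x _) rk_pull.
Qed.

(** A facet and a point off it span the whole space, so affine functions that
    vanish on a facet are proportional. *)
Lemma height_unique C u v z : opposite C -> height C u ->
  (forall i, i \in C -> ev v (x i) = 0) -> (homog z <= hmx x T)%MS ->
  ev v z = ev v (x a) * ev u z.
Proof.
move=> oC [_ CE ua] vC zT.
apply/eqP; rewrite -subr_eq0 -evZ -evN -evD; apply/eqP.
apply: ev_hmx (submx_trans zT (hmx_pull oC)) _ => i.
rewrite !inE evD evN evZ => /orP[/eqP ->|iC]; first by rewrite ua mulr1 subrr.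
have : i \in zeros x T u by rewrite -CE.
by rewrite inE => /andP[_ /eqP ->]; rewrite vC// mulr0 subr0.
Qed.

(** The difference of the two heights is nonnegative on one cone and nonpositive
    on the other; on the intersection it vanishes, and it vanishes only at
    the common vertices of the two cones. *)
Lemma pull_inter C C' : opposite C -> opposite C' ->
  hull x (a |: C) `&` hull x (a |: C') `<=` hull x (a |: (C :&: C')).
Proof.
move=> /heightP[u [u0 CE ua]] /heightP[v [v0 CE' va]] z [zC zC'].
pose w := v - u; have wE z' : ev w z' = ev v z' - ev u z' by rewrite evD evN.
have wC i : i \in a |: C -> 0 <= ev w (x i).
  rewrite CE !inE wE => /orP[/eqP ->|/eqP ->]; first by rewrite ua va subrr.
  by rewrite subr0.
have wC' i : i \in a |: C' -> 0 <= ev (- w) (x i).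
  rewrite evN CE' !inE wE opprB => /orP[/eqP ->|/eqP ->]; first by rewrite ua va subrr.
  by rewrite subr0.
have wz : ev w z = 0.
  apply/eqP; rewrite eq_le (ev_hull_ge0 wC zC) andbT.
  by rewrite -oppr_ge0 -evN (ev_hull_ge0 wC' zC').
have : (hull x (a |: C) `&` [set z | ev w z = 0]) z by [].
rewrite hull_zeros//; apply: hullS; apply/fintype.subsetP => i.
rewrite CE CE' !inE wE => /andP[/orP[->//|/eqP ui]].
by rewrite ui subr0 eqxx => ->; rewrite orbT.
Qed.

(** Follow the ray from the apex through [z]. By [facet_separating] it stays in the
    polytope as long as all heights of opposite facets are nonnegative, and it
    leaves through the facet [C] for which the height of [z] is least. *)
Lemma pull_cover z : hull x T z -> z <> x a ->
  exists2 C, opposite C & hull x (a |: C) z.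
Proof.
move=> zT za.
have /choice[u uP] : forall C, exists u, opposite C -> height C u.
  move=> C; have [/heightP[u uC]|nC] := pselect (opposite C); first by exists u.
  by exists 0 => /nC.
have xaT : hull x T (x a) by apply: mem_hull; rewrite inE.
(* Points of the ray, at parameter [s], as long as the heights are nonnegative. *)
have ray s : 0 < s -> (forall C, opposite C -> s * (1 - ev (u C) z) <= 1) ->
    hull x T ((1 - s) *: x a + s *: z).
  move=> s0 sC; apply: contrapT => np.
  have pT : (homog ((1 - s) *: x a + s *: z) <= hmx x T)%MS.
    by rewrite homog_segment addmx_sub// scalemx_sub// hull_hmx.
  have [v [Tv vp rv]] := facet_separating pT np.
  have fv : isface x T (zeros x T v) by exists v.
  have vz : 0 <= ev v z by apply: ev_hull_ge0 Tv zT.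
  have [av|av] := boolP (a \in zeros x T v).
    move: vp; rewrite ev_segment; move: av; rewrite inE => /andP[_ /eqP ->].
    by rewrite mulr0 add0r ltNge mulr_ge0// ltW.
  have oC : opposite (zeros x T v) by [].
  have [u0 CE ua] := uP _ oC.
  move: vp; rewrite (height_unique oC (uP _ oC) _ pT); last first.
    by move=> i; rewrite inE => /andP[_ /eqP].
  rewrite ltNge mulr_ge0 ?Tv ?inE// ev_segment ua mulr1.
  by have := sC _ oC; lra.
have [C [oC Cz Cmin]] : exists C, [/\ opposite C, ev (u C) z < 1 &
    forall C', opposite C' -> ev (u C) z <= ev (u C') z].
  have [C oC Cz] : exists2 C, opposite C & ev (u C) z < 1.
    apply: contrapT => nC.
    have [w Tw aE] := x_vertex a.
    have wz : 0 < ev w z.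
      rewrite lt0r (ev_hull_ge0 Tw zT) andbT; apply: contra_notN za => /eqP wz.
      have : (hull x T `&` [set z | ev w z = 0]) z by [].
      by rewrite hull_zeros// -aE hull1.
    (* Otherwise the whole ray lies in the polytope; the function [w], which
       exposes the apex, is bounded by [M] on the polytope but not on the ray. *)
    pose M := \sum_i ev w (x i).
    have wM i : 0 <= ev w (x i) <= M.
      rewrite Tw ?inE//= /M (bigD1 i)//= lerDl sumr_ge0// => j _.
      by rewrite Tw ?inE.
    have M0 : 0 <= M by apply: sumr_ge0 => i _; rewrite Tw ?inE.
    pose s := (M + 1) / ev w z.
    have s0 : 0 < s by rewrite divr_gt0// ltr_wpDl.
    have /(ev_hull_ge0 (u := M *: one_ev R m - w)) : hull x T ((1 - s) *: x a + s *: z).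
      apply: ray => // C oC; apply: le_trans ler01.
      rewrite pmulr_rle0// subr_le0 leNgt; apply/negP => Cz; apply: nC; by exists C.
    rewrite evD evZ ev_one evN mulr1 ev_segment => h.
    have : 0 <= M - ((1 - s) * ev w (x a) + s * ev w z).
      by apply: h => i _; rewrite evD evZ ev_one evN mulr1 subr_ge0; case/andP: (wM i).
    have -> : ev w (x a) = 0.
      have : a \in [set a]%SET by rewrite inE.
      by rewrite aE inE => /andP[_ /eqP].
    rewrite mulr0 add0r /s divfK ?gt_eqF//; lra.
  pose P := [pred C : {set 'I_N} | `[< opposite C >]].
  have PC : P C by exact/asboolP.
  case: (@arg_minP _ _ _ C P (fun C => ev (u C) z) PC) => C1 /asboolP oC1 C1min.
  exists C1; split=> //; first exact: le_lt_trans (C1min _ PC) Cz.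
  by move=> C' /asboolP; exact: C1min.
exists C => //; have [u0 CE ua] := uP _ oC; pose t := 1 - ev (u C) z.
have uz : 0 <= ev (u C) z by apply: ev_hull_ge0 zT => i _; exact: u0.
have t0 : 0 < t by rewrite subr_gt0.
have t1 : t <= 1 by rewrite /t lerBlDr lerDl.
pose p := (1 - t^-1) *: x a + t^-1 *: z.
have pT : hull x T p.
  apply: ray; rewrite ?invr_gt0// => C' oC'.
  by rewrite ler_pdivrMl// mulr1 /t lerD2l lerN2 Cmin.
have pC : hull x C p.
  rewrite CE -hull_zeros => [|i _]; last exact: u0.
  split=> //=; rewrite /p ev_segment ua mulr1.
  by rewrite /t; field; rewrite gt_eqF.
have -> : z = (1 - t) *: x a + t *: p.
  rewrite /p scalerDr !scalerA mulfV ?gt_eqF// scale1r addrA -scalerDl.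
  by rewrite mulrBr mulr1 mulfV ?gt_eqF// addrA subrK subrr scale0r add0r.
apply: hull_segment; first by rewrite ltW.
  by apply: mem_hull; rewrite finset.setU11.
by apply: hullS pC; exact: finset.subsetUr.
Qed.

(** The faces of a cone are the hulls of its subsets as soon as its base is a
    simplex. *)
Definition pulling : set (set 'rV[R]_m) :=
  [set S | exists C B, [/\ opposite C, B \subset a |: C & S = hull x B]].

Hypothesis opp_simp : forall C, opposite C -> rk x C = #|C|.

Lemma rk_pull_card C : opposite C -> rk x (a |: C) = #|a |: C|.
Proof.
move=> oC; have [_ rC aC] := oC.
by rewrite rk_pull// -rC opp_simp// cardsU1 aC.
Qed.

Lemma pulling_complex : simplicial_complex pulling.
Proof.
split.
- apply: (@sub_finite_set _ _ (hull x @` [set: {set 'I_N}])).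
    by move=> S [C [B [_ _ ->]]]; exists B.
  by apply: finite_image; exact: finite_finset.
- move=> S [C [B [oC BC ->]]]; apply: simplex_hull.
  exact: simplex_rk_sub (rk_pull_card oC) BC.
- move=> S F [C [B [oC BC ->]]] /face_hullP[B' fB' ->]; exists C, B'; split=> //.
  exact: fintype.subset_trans (isface_sub fB') BC.
move=> S S' [C [B [oC BC ->]]] [C' [B' [oC' BC' ->]]].
have rC := rk_pull_card oC; have rC' := rk_pull_card oC'.
suff -> : hull x B `&` hull x B' = hull x (B :&: B').
  split; apply/face_hullP; exists (B :&: B') => //; apply: simplex_isface.
  - exact: simplex_rk_sub rC BC.
  - exact: finset.subsetIl.
  - exact: simplex_rk_sub rC' BC'.
  - exact: finset.subsetIr.
pose D := a |: (C :&: C').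
have DC : D \subset a |: C by rewrite finset.setUS ?finset.subsetIl.
have DC' : D \subset a |: C' by rewrite finset.setUS ?finset.subsetIr.
apply/seteqP; split=> z.
  move=> [zB zB']; have zD : hull x D z.
    by apply: (pull_inter oC oC'); split; [exact: hullS BC _ zB|exact: hullS BC' _ zB'].
  have : (hull x B `&` hull x D) z by [].
  rewrite (simplex_inter rC BC DC) => zBD.
  have : (hull x B' `&` hull x D) z by [].
  rewrite (simplex_inter rC' BC' DC') => zBD'.
  have : (hull x (B :&: D) `&` hull x (B' :&: D)) z by [].
  have rD := simplex_rk_sub rC DC.
  rewrite (simplex_inter rD (finset.subsetIr _ _) (finset.subsetIr _ _)).
  by apply: hullS; rewrite finset.setISS ?finset.subsetIl.
by move=> zBB; split; apply: hullS zBB; rewrite ?finset.subsetIl ?finset.subsetIr.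
Qed.

Lemma pulling_triangulation C0 : opposite C0 -> triangulation (hull x T) pulling.
Proof.
move=> oC0; split; first exact: pulling_complex.
- move=> v [C [B [oC BC vE]]].
  have /finset.set0Pn[i iB] : B != finset.set0.
    by apply: contra_eq_neq vE => ->; rewrite hull0; apply/eqP => /seteqP[/(_ v erefl)].
  have : hull x B (x i) by exact: mem_hull.
  rewrite -vE => /= <-; apply/face_hullP; exists [set i]%SET; rewrite ?hull1//.
apply/seteqP; split=> z.
  by move=> [S [C [B [oC BC ->]]]]; apply: hullS; exact: finset.subsetT.
move=> zT; have [->|/(pull_cover zT)[C oC zC]] := pselect (z = x a).
  exists (hull x (a |: C0)); first by exists C0, (a |: C0).
  by apply: mem_hull; rewrite finset.setU11.
by exists (hull x (a |: C)) => //; exists C, (a |: C).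
Qed.

Lemma pulling_maximal :
  maximal_simplices pulling = [set S | exists2 C, opposite C & S = hull x (a |: C)].
Proof.
apply/seteqP; split=> S.
  move=> [[C [B [oC BC ->]]] max]; exists C => //; apply/esym/max; last exact: hullS.
  by exists C, (a |: C).
move=> [C oC ->]; split; first by exists C, (a |: C).
move=> S' [C' [B [oC' BC' ->]]] CB; suff -> : B = a |: C by [].
have CsB : a |: C \subset B.
  apply/fintype.subsetP => i iC; apply: hull_vertex => //; apply: CB.
  exact: mem_hull.
apply/eqP; rewrite eq_sym eqEcard CsB /= -(rk_pull_card oC) rk_pull//.
by rewrite -(rk_pull oC') (rk_pull_card oC') subset_leq_card.
Qed.

End Pulling.

(** * Braxtopes *)

Section Braxtope.
Variables (R : realType) (m n d : nat) (x : 'I_n.+1 -> 'rV[R]_m) (Q : set 'rV[R]_m).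
Hypotheses (hd : (3 <= d)%N) (hn : (d <= n)%N) (hQ : braxtope d x Q).
Local Notation T := [set: 'I_n.+1]%SET.

Definition pos (t : nat) : 'I_n.+1 := inord t.
Local Notation img := (img n pos).
Local Notation L := (facelat x).

Lemma pos_inj (s t : nat) : (s <= n)%N -> (t <= n)%N -> pos s = pos t -> s = t.
Proof. by move=> sn tn /(congr1 val); rewrite /= !inordK. Qed.

Lemma xatE t : (t <= n)%N -> xat x t = x (pos t).
Proof. by move=> tn; rewrite /xat (minn_idPl tn). Qed.

Lemma imgT : T = img xpredT.
Proof.
apply/setP => i; rewrite inE; apply/esym/imgP; exists i.
  by split=> //; rewrite -ltnS.
by rewrite /pos inord_val.
Qed.

Lemma hull_img (tau : pred nat) (S : set 'rV[R]_m) :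
  (forall t, (t <= n)%N -> tau t -> S (xat x t)) ->
  (forall z, S z -> exists t, [/\ (t <= n)%N, tau t & z = xat x t]) ->
  conv S = hull x (img tau).
Proof.
move=> h1 h2; rewrite hull_conv; congr conv; apply/seteqP; split=> z.
  move=> /h2[t [tn tt ->]]; exists (pos t); last by rewrite xatE.
  by rewrite /= mem_img//; exact: pos_inj.
by move=> [i /= /imgP[t [tn tt] ->] <-]; rewrite -xatE//; exact: h1.
Qed.

Lemma braxT_hull i : (i <= n - d + 1)%N -> braxT d x i = hull x (img (posT d i)).
Proof.
move=> idn; apply: hull_img => [t tn tT|z [t /= tT <-]].
  by exists t => //=; move: tT; rewrite /posT; lia.
by exists t; rewrite /posT; split=> //; lia.
Qed.

Lemma braxE_hull j : (2 <= j <= n)%N -> braxE d x j = hull x (img (posE d n j)).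
Proof.
move=> jn; apply: hull_img => [t tn|z].
  rewrite /posE; have [->|t0] := eqVneq t 0%N; first by left; left.
  move=> /= tE; have [tj|jt] := ltnP t j.
    left; right; exists (j - t)%N => /=; first by lia.
    by congr (xat x _); lia.
  have [jt'|jt'] := eqVneq t j.
    right; exists 1%N => /=; first by lia.
    by rewrite /xat; congr (x (inord _)); lia.
  right; exists (t - j)%N => /=; first by lia.
  by congr (xat x _); lia.
have xat_min t : xat x t = xat x (minn t n) by rewrite /xat -minnA minnn.
case=> [[->|[k /= kd <-]]|[k /= kd <-]]; first by exists 0%N.
  by exists (j - k)%N; rewrite /posE; split=> //; lia.
by exists (minn (j + k) n); rewrite -xat_min /posE; split=> //; lia.
Qed.

Lemma braxJ_hull i : (1 <= i <= n - d + 1)%N -> braxJ d x i = hull x (img (posJ i d)).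
Proof.
move=> idn; apply: hull_img => [t tn /orP[/eqP ->|tJ]|z [->|[t /= tT <-]]].
- by left.
- by right; exists t => //=; lia.
- by exists 0%N.
- by exists t; rewrite /posJ; split=> //; lia.
Qed.

Lemma brax_polytope : Q = hull x T.
Proof. by have [Qp _ [_ Qv] _] := hQ; exact: vertices_hull. Qed.

Lemma brax_vertex i : isface x T [set i]%SET.
Proof.
have [Qp _ [xi Qv] _] := hQ; apply/(vertex_isface _ xi); rewrite -brax_polytope Qv.
by exists i.
Qed.

Lemma brax_rk : rk x T = d.+1.
Proof.
have [_ Qd _ _] := hQ; move: Qd; rewrite brax_polytope /Defs.dim affrank_hull.
by lia.
Qed.

Lemma brax_facet A : facets Q (hull x A) <-> A \in L /\ (rk x A).+1 = rk x T.
Proof.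
rewrite /facets /= /Defs.dim brax_polytope !affrank_hull (face_facelat _ brax_vertex).
by split=> -[-> ?]; split=> //; lia.
Qed.

Lemma brax_T i : (i <= n - d + 1)%N ->
  img (posT d i) \in L /\ (rk x (img (posT d i))).+1 = rk x T.
Proof.
move=> idn; apply/brax_facet; have [_ _ _ ->] := hQ.
by left; exists i => //; exact: braxT_hull.
Qed.

Lemma brax_E j : (2 <= j <= n)%N ->
  img (posE d n j) \in L /\ (rk x (img (posE d n j))).+1 = rk x T.
Proof.
move=> jn; apply/brax_facet; have [_ _ _ ->] := hQ.
by right; exists j => //; exact: braxE_hull.
Qed.

Lemma brax_is_array : brax_array L (rk x) d n pos T.
Proof.
split.
- by rewrite hd.
- exact: pos_inj.
- exact: imgT.
- exact: brax_rk.
- exact/facelatP/isface_refl.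
- by move=> i /brax_T[].
- by move=> j /brax_E[].
move=> C CL _ rC; have : facets Q (hull x C) by apply/brax_facet.
have [_ _ _ ->] := hQ; case=> [[i idn]|[j jn]].
  rewrite braxT_hull// => iC; left; exists i => //.
  have [/facelatP fT _] := brax_T idn; move/facelatP : CL => fC.
  exact: isface_hull_inj fC fT (esym iC).
rewrite braxE_hull// => jC; right; exists j => //.
have [/facelatP fE _] := brax_E jn; move/facelatP : CL => fC.
exact: isface_hull_inj fC fE (esym jC).
Qed.

Lemma pos0_E j : pos 0 \in img (posE d n j).
Proof. by rewrite (mem_img pos_inj). Qed.

(** T_0 and all E_j contain x_0. *)
Lemma brax_opposite C : opposite x (pos 0) C <->
  exists2 i, (1 <= i <= n - d + 1)%N & C = img (posT d i).
Proof.
split=> [[/facelatP CL rC aC]|[i idn ->]].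
  have [[i idn CE]|[j _ CE]] := ba_coatom brax_is_array CL (finset.subsetT _) rC.
    exists i => //; rewrite idn andbT lt0n; apply: contraNneq aC => i0.
    by rewrite CE i0 (mem_img pos_inj)// /posT; lia.
  by move: aC; rewrite CE pos0_E.
have [|/facelatP fT rT] := @brax_T i; first by lia.
by split=> //; rewrite (mem_img pos_inj)// /posT; lia.
Qed.

Lemma rk_posT i : (i <= n - d + 1)%N -> rk x (img (posT d i)) = d.
Proof. by move=> /brax_T[_]; rewrite brax_rk => -[]. Qed.

Lemma brax_opposite_simp C : opposite x (pos 0) C -> rk x C = #|C|.
Proof.
move=> /brax_opposite[i idn ->].
by rewrite rk_posT ?(card_posT pos_inj)//; lia.
Qed.

Lemma cone_posT i : (1 <= i <= n - d + 1)%N -> (pos 0 |: img (posT d i)) = img (posJ i d).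
Proof.
move=> idn; apply/setP => k; rewrite !inE; apply/orP/imgP.
  case=> [/eqP ->|/imgP[t [tn tT] ->]]; first by exists 0%N.
  by exists t => //; rewrite /posJ -/(posT d i t) tT orbT.
move=> [t [tn /orP[/eqP ->|tT]] ->]; first by left.
by right; rewrite (mem_img pos_inj).
Qed.

Lemma brax_maximal : maximal_simplices (pulling x (pos 0)) =
  [set braxJ d x i | i in [set i | 1 <= i <= n - d + 1]%N].
Proof.
rewrite pulling_maximal; [|exact: brax_vertex|exact: brax_opposite_simp].
apply/seteqP; split=> S.
  move=> [C /brax_opposite[i idn ->] ->]; exists i => //.
  by rewrite cone_posT// braxJ_hull.
move=> [i idn <-]; exists (img (posT d i)); first by apply/brax_opposite; exists i.
by rewrite cone_posT// braxJ_hull.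
Qed.

Lemma brax_shallow : shallow Q (pulling x (pos 0)).
Proof.
move=> k S [C [B [oC BC ->]]] dB.
have rB : rk x B = k.+1 by move: dB; rewrite /Defs.dim affrank_hull; lia.
have cB : #|B| = k.+1.
  by rewrite -rB; apply/esym/(simplex_rk_sub (rk_pull_card brax_opposite_simp oC)).
have /brax_opposite[i idn CE] := oC.
rewrite CE cone_posT// in BC.
have vL t : (t <= n)%N -> [set pos t]%SET \in L /\ rk x [set pos t]%SET = 1%N.
  move=> _; split; first exact/facelatP/brax_vertex.
  apply/eqP; rewrite eqn_leq -{1}(cards1 (pos t)) rk_card /=.
  have /isface_rk : isface x [set pos t]%SET finset.set0 by exact: isface0.
  by move=> /(_ _)/(leq_trans _); apply=> //; rewrite eq_sym; apply/finset.set0Pn; exists (pos t); rewrite inE.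
have i0 : (0 < i)%N by lia.
have idn' : (i + d <= n.+1)%N by lia.
have B0 : (0 < #|B|)%N by rewrite cB.
have [A [AL BA rA]] :=
  shallow_carrier (facelat_graded x) brax_is_array i0 idn' rk_posT vL BC B0.
exists (hull x A); split; last exact: hullS.
  by rewrite brax_polytope; apply/face_facelat => //; exact: brax_vertex.
by rewrite /Defs.dim affrank_hull; lia.
Qed.

Lemma brax_toric_h : toric_h Q = stacked_h d (n - d).
Proof.
rewrite brax_polytope /toric_h (facelat_h _ (A := T)); last exact/facelatP/isface_refl.
exact (ba_toric (facelat_graded x) (facelat_toric x) brax_is_array).
Qed.

Lemma brax_h_vector : h_vector Q = 1 :: rcons (nseq (d - 1) (n - d + 1)%N%:Z) 1.
Proof.
have dQ : (affrank Q).-1 = d by rewrite brax_polytope affrank_hull brax_rk.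
rewrite /h_vector dQ brax_toric_h; apply: (@eq_from_nth _ 0).
  by rewrite size_map size_iota /= size_rcons size_nseq; lia.
move=> i; rewrite size_map size_iota => id1.
rewrite (nth_map 0%N) ?size_iota// nth_iota// add0n stacked_h_entry//.
case: i id1 => [|i] id1 /=.
  by have -> : (0 == d)%N = false by [lia]; rewrite subr0 mul0rn addr0.
rewrite nth_rcons size_nseq nth_nseq; have [id2|id2] := ltnP i (d - 1).
  by have -> : (i.+1 == d)%N = false by [lia]; rewrite subr0; lia.
have -> : (i == d - 1)%N by lia.
have -> : (i.+1 == d)%N by lia.
by rewrite subrr mul0rn addr0.
Qed.

End Braxtope.

Theorem theorem4 (R : realType) (m n d : nat)
    (x : 'I_n.+1 -> 'rV[R]_m) (Q : set 'rV[R]_m)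
    (hd : (3 <= d)%N) (hn : (d <= n)%N) (hQ : braxtope d x Q) :
  (exists Delta : set (set 'rV[R]_m),
    [/\ triangulation Q Delta,
        maximal_simplices Delta
          = [set braxJ d x i | i in [set i | 1 <= i <= n - d + 1]%N]
      & shallow Q Delta])
  /\ h_vector Q = 1 :: rcons (nseq (d - 1) (n - d + 1)%N%:Z) 1.
Proof.
split; last exact: (brax_h_vector hd hn hQ).
exists (pulling x (pos n 0)); split.
- rewrite (brax_polytope hQ); apply: (@pulling_triangulation _ _ _ _ _ _ _ (img n (pos n) (posT d 1))).
  + exact: (brax_vertex hQ).
  + exact: (brax_opposite_simp hd hn hQ).
  + by apply/(brax_opposite hd hn hQ); exists 1%N => //; lia.
- exact: (brax_maximal hd hn hQ).
- exact: (brax_shallow hd hn hQ).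
Qed.
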